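(* Let $k\ge2$ and denote by $k.\mathrm{q.Reg}$ the category of $k$-ary quadratic regular operads. For $\mathcal{P},\mathcal{Q},\mathcal{R}$ in $k.\mathrm{q.Reg}$ there is a natural isomorphism $$\mathrm{Hom}_{k.\mathrm{q.Reg}}(\mathcal{P}\,\blacksquare\,\mathcal{Q},\,\mathcal{R})\;\cong\;\mathrm{Hom}_{k.\mathrm{q.Reg}}(\mathcal{P},\,\mathcal{Q}^!\,\square\,\mathcal{R}).$$
   Context: The ground field $\mathbb{K}$ has characteristic $0$. A regular operad is an operad of the form $\Sigma(\mathcal{P}')(n)=\mathcal{P}'_n\otimes\mathbb{K}[\mathbb{S}_n]$ with $\mathcal{P}'$ a non-symmetric operad (operad without symmetric group actions). A $k$-ary quadratic regular operad is $\Sigma(\mathcal{F}(V')/(R'))$, with $V'$ a finite dimensional vector space placed in arity $k$, $\mathcal{F}(V')$ the free non-symmetric operad, and $R'\subset\mathcal{F}(V')(2k-1)=\bigoplus_{i=1}^k V'\otimes V'$, the $i$-th summand being spanned by the compositions $\mu\circ_i\nu$ ($\nu$ inserted in the $i$-th input of $\mu$). Morphisms in $k.\mathrm{q.Reg}$ are the morphisms of operads induced by linear maps between the spaces of generators $V'\to W'$ (mapping relations into relations). Koszul dual: $(\Sigma(\mathcal{F}(V')/(R')))^!=\Sigma(\mathcal{F}(V'^* )/(R'^\perp))$, the orthogonal being for the pairing $\langle\mu\circ_i\nu,\zeta\circ_j\xi\rangle=\delta_{ij}\varepsilon_i\,\zeta(\mu)\xi(\nu)$ with $\varepsilon_i=(-1)^{(i-1)(k-1)}$.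 For $\mathcal{P}=\Sigma(\mathcal{F}(V')/(R'))$ and $\mathcal{Q}=\Sigma(\mathcal{F}(W')/(S'))$, let $\Phi((\mu\otimes\mu')\circ_i(\nu\otimes\nu'))=(\mu\circ_i\nu)\otimes(\mu'\circ_i\nu')$, a map $\mathcal{F}(V'\otimes W')(2k-1)\to\mathcal{F}(V')(2k-1)\otimes\mathcal{F}(W')(2k-1)$, and let $\Psi$ in the opposite direction be the transpose of $\Phi_{V'^*,W'^*}$ for the pairings: $\Psi((\mu\circ_i\nu)\otimes(\mu'\circ_j\nu'))=\delta_{ij}\varepsilon_i(\mu\otimes\mu')\circ_i(\nu\otimes\nu')$. Then $$\mathcal{P}\,\square\,\mathcal{Q}=\Sigma\Big(\mathcal{F}(V'\otimes W')/\big(\Phi^{-1}(R'\otimes\mathcal{F}(W')(2k-1)+\mathcal{F}(V')(2k-1)\otimes S')\big)\Big),\qquad \mathcal{P}\,\blacksquare\,\mathcal{Q}=\Sigma\big(\mathcal{F}(V'\otimes W')/(\Psi(R'\otimes S'))\big).$$ *)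

(* Defs.v *)
From HB Require Import structures.
From mathcomp Require Import all_boot all_order all_fingroup all_algebra.
From mathcomp Require Import boolp zify.

Set Implicit Arguments.
Unset Strict Implicit.
Unset Printing Implicit Defensive.
Import generic_quotient GRing.Theory.
Local Open Scope ring_scope.
Local Open Scope quotient_scope.

Definition bilin (K : fieldType) (U V W : lmodType K) (b : U -> V -> W) : Prop :=
  (forall u, linear (b u)) /\ (forall v, linear (b^~ v)).

Section Bilin.
Variables (K : fieldType) (U V W : lmodType K) (b : U -> V -> W).
Hypothesis hb : bilin b.
Let lr u := GRing.isLinear.Build _ _ _ _ (b u) (hb.1 u).
Let ll v := GRing.isLinear.Build _ _ _ _ (b^~ v) (hb.2 v).
Let br u : {linear V -> W} := HB.pack (b u) (lr u).
Let bl v : {linear U -> W} := HB.pack (b^~ v) (ll v).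
Lemma bilin_sumr I (r : seq I) P (F : I -> V) u :
  b u (\sum_(i <- r | P i) F i) = \sum_(i <- r | P i) b u (F i).
Proof. exact: (linear_sum (br u)). Qed.
Lemma bilin_suml I (r : seq I) P (F : I -> U) v :
  b (\sum_(i <- r | P i) F i) v = \sum_(i <- r | P i) b (F i) v.
Proof. exact: (linear_sum (bl v)). Qed.
Lemma bilinZr a u v : b u (a *: v) = a *: b u v.
Proof. exact: (linearZZ (br u)). Qed.
Lemma bilinZl a u v : b (a *: u) v = a *: b u v.
Proof. exact: (linearZZ (bl v)). Qed.
Lemma bilin0r u : b u 0 = 0.
Proof. exact: (linear0 (br u)). Qed.
Lemma bilin0l v : b 0 v = 0.
Proof. exact: (linear0 (bl v)). Qed.
Lemma bilinDr u v w : b u (v + w) = b u v + b u w.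
Proof. exact: (linearD (br u)). Qed.
Lemma bilinDl u v w : b (u + v) w = b u w + b v w.
Proof. exact: (linearD (bl w)). Qed.
Lemma bilinBr u v w : b u (v - w) = b u v - b u w.
Proof. exact: (linearB (br u)). Qed.
Lemma bilinBl u v w : b (u - v) w = b u w - b v w.
Proof. exact: (linearB (bl w)). Qed.
End Bilin.

Section Tensor.
Variable K : fieldType.
Implicit Types V W : vectType K.

Definition tensor V W : vectType K := 'M[K]_(\dim {:V}, \dim {:W}).

Definition tens V W (v : V) (w : W) : tensor V W :=
  \matrix_(i, j) (coord (vbasis {:V}) i v * coord (vbasis {:W}) j w).

Definition tlift V W (U : lmodType K) (b : V -> W -> U) (t : tensor V W) : U :=
  \sum_i \sum_j (t : 'M_(_, _)) i j *: b (vbasis {:V})`_i (vbasis {:W})`_j.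

Lemma tlift_is_linear V W (U : lmodType K) (b : V -> W -> U) : linear (tlift b).
Proof.
move=> a s t; rewrite /tlift scaler_sumr -big_split; apply: eq_bigr => i _ /=.
rewrite scaler_sumr -big_split; apply: eq_bigr => j _ /=.
by rewrite !mxE scalerDl scalerA.
Qed.
HB.instance Definition _ V W (U : lmodType K) (b : V -> W -> U) :=
  GRing.isLinear.Build K (tensor V W) U _ (tlift b) (tlift_is_linear b).

Lemma tens_bilin V W : bilin (@tens V W).
Proof.
split=> [v a w w'|w a v v']; apply/matrixP=> i j; rewrite !mxE linearP.
  by rewrite mulrDr mulrCA.
by rewrite mulrDl mulrA.
Qed.

Lemma tlift_tens V W (U : lmodType K) (b : V -> W -> U) v w :
  bilin b -> tlift b (tens v w) = b v w.
Proof.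
move=> hb; rewrite [v in RHS](coord_vbasis (memvf v)) (bilin_suml hb).
apply: eq_bigr => i _.
rewrite [w in RHS](coord_vbasis (memvf w)) (bilin_sumr hb).
apply: eq_bigr => j _.
by rewrite (bilinZl hb) (bilinZr hb) scalerA mxE.
Qed.

Lemma tens_basis V W (t : tensor V W) : t = tlift (@tens V W) t.
Proof.
rewrite {1}[t]matrix_sum_delta; apply: eq_bigr => i _; apply: eq_bigr => j _.
congr (_ *: _); apply/matrixP=> i' j'; rewrite !mxE.
by rewrite !coord_free ?(basis_free (vbasisP _)) // -natrM mulnb eq_sym [j == _]eq_sym.
Qed.

(* the universal property of the tensor product *)
Lemma tlift_unique V W (U : lmodType K) (h : {linear tensor V W -> U}) t :
  h t = tlift (fun v w => h (tens v w)) t.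
Proof.
rewrite {1}(tens_basis t) linear_sum; apply: eq_bigr => i _.
by rewrite linear_sum; apply: eq_bigr => j _; rewrite linearZ.
Qed.

Lemma tensor_ext V W (U : lmodType K) (h h' : tensor V W -> U) :
  linear h -> linear h' -> (forall v w, h (tens v w) = h' (tens v w)) -> h =1 h'.
Proof.
move=> lh lh' e t.
pose H : {linear tensor V W -> U} :=
  HB.pack h (GRing.isLinear.Build _ _ _ _ h lh).
pose H' : {linear tensor V W -> U} :=
  HB.pack h' (GRing.isLinear.Build _ _ _ _ h' lh').
rewrite -[h t]/(H t) -[h' t]/(H' t) (tlift_unique H) (tlift_unique H').
by apply: eq_bigr => i _; apply: eq_bigr => j _; rewrite /= e.
Qed.

Definition tmap V W V' W' (f : 'Hom(V, V')) (g : 'Hom(W, W')) :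
    'Hom(tensor V W, tensor V' W') :=
  linfun (tlift (fun v w => tens (f v) (g w))).

Lemma tmap_bilin V W V' W' (f : 'Hom(V, V')) (g : 'Hom(W, W')) :
  bilin (fun v w => tens (f v) (g w)).
Proof.
split=> [v a w w'|w a v v']; rewrite linearP.
  by have [h _] := tens_bilin V' W'; rewrite h.
by have [_ h] := tens_bilin V' W'; rewrite (h (g w)).
Qed.

Lemma tmapE V W V' W' (f : 'Hom(V, V')) (g : 'Hom(W, W')) v w :
  tmap f g (tens v w) = tens (f v) (g w).
Proof. by rewrite lfunE /= tlift_tens //; apply: tmap_bilin. Qed.

Definition tensv V W (A : {vspace V}) (B : {vspace W}) : {vspace tensor V W} :=
  <<[seq tens v w | v <- vbasis A, w <- vbasis B]>>%VS.

Lemma tensv_mem V W (A : {vspace V}) (B : {vspace W}) v w :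
  v \in A -> w \in B -> tens v w \in tensv A B.
Proof.
move=> /coord_vbasis -> /coord_vbasis ->.
rewrite (bilin_suml (tens_bilin V W)) memv_suml // => i _.
rewrite (bilin_sumr (tens_bilin V W)) memv_suml // => j _.
rewrite (bilinZl (tens_bilin V W)) (bilinZr (tens_bilin V W)) !memvZ //.
by apply/memv_span/allpairs_f; apply: mem_nth; rewrite size_tuple.
Qed.

Lemma tensv_sub V W (A : {vspace V}) (B : {vspace W}) (C : {vspace tensor V W}) :
  (forall v w, v \in A -> w \in B -> tens v w \in C) -> (tensv A B <= C)%VS.
Proof.
move=> h; apply/span_subvP => _ /allpairsP[[v w] [/= hv hw ->]].
by apply: h; apply: vbasis_mem.
Qed.

End Tensor.

Record nsOperad (K : fieldType) := NsOperad {
  nso_sort :> nat -> lmodType K;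
  nso_one : nso_sort 1;
  nso_comp : forall m n p, (m + n)%N = p.+1 -> 'I_m ->
    nso_sort m -> nso_sort n -> nso_sort p;
  nso_bilin : forall m n p (e : (m + n)%N = p.+1) (i : 'I_m),
    bilin (nso_comp e i);
  nso_comp1 : forall m (e : (m + 1)%N = m.+1) (i : 'I_m) x,
    nso_comp e i x nso_one = x;
  nso_1comp : forall m (e : (1 + m)%N = m.+1) (i : 'I_1) x,
    nso_comp e i nso_one x = x;
  nso_seq : forall m n l p q r (e1 : (m + n)%N = p.+1) (e2 : (p + l)%N = r.+1)
      (e3 : (n + l)%N = q.+1) (e4 : (m + q)%N = r.+1)
      (i : 'I_m) (j : 'I_n) (h : 'I_p) x y z,
    h = (i + j)%N :> nat ->
    nso_comp e2 h (nso_comp e1 i x y) z = nso_comp e4 i x (nso_comp e3 j y z);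
  nso_par : forall m n l p q r (e1 : (m + n)%N = p.+1) (e2 : (p + l)%N = r.+1)
      (e3 : (m + l)%N = q.+1) (e4 : (q + n)%N = r.+1)
      (i j : 'I_m) (i' : 'I_q) (j' : 'I_p) x y z,
    (i < j)%N -> i' = i :> nat -> j'.+1 = (j + n)%N :> nat ->
    nso_comp e2 j' (nso_comp e1 i x y) z =
    nso_comp e4 i' (nso_comp e3 j x z) y
}.
Arguments nso_one {K} P : rename.
Arguments nso_comp {K} P {m n p} e i x y : rename.
Arguments nso_bilin {K P m n p} e i : rename.

Record nsHom (K : fieldType) (P Q : nsOperad K) := NsHom {
  nsh_map :> forall n, P n -> Q n;
  nsh_linear : forall n, linear (@nsh_map n);
  nsh_one : nsh_map (nso_one P) = nso_one Q;
  nsh_comp : forall m n p (e : (m + n)%N = p.+1) (i : 'I_m) x y,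
    nsh_map (nso_comp P e i x y) = nso_comp Q e i (nsh_map x) (nsh_map y)
}.
Arguments nsh_map {K P Q} _ {n} _.

HB.instance Definition _ K (P Q : nsOperad K) (f : nsHom P Q) n :=
  GRing.isLinear.Build K (P n) (Q n) _ (@nsh_map K P Q f n) (@nsh_linear K P Q f n).

Section NsHomComp.
Variables (K : fieldType) (P Q R : nsOperad K) (g : nsHom Q R) (f : nsHom P Q).
Fact nsHom_comp_linear n : linear (fun x : P n => g n (f n x)).
Proof. by move=> a x y; rewrite !linearP. Qed.
Fact nsHom_comp_one : g 1%N (f 1%N (nso_one P)) = nso_one R.
Proof. by rewrite !nsh_one. Qed.
Fact nsHom_comp_comp m n p (e : (m + n)%N = p.+1) (i : 'I_m) x y :
  g p (f p (nso_comp P e i x y)) = nso_comp R e i (g m (f m x)) (g n (f n y)).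
Proof. by rewrite !nsh_comp. Qed.
Definition nsHom_comp : nsHom P R :=
  @NsHom K P R (fun n x => g n (f n x)) nsHom_comp_linear nsHom_comp_one
    nsHom_comp_comp.
End NsHomComp.

Section Free.
Variables (K : fieldType) (k : nat) (V : lmodType K).

Inductive term : nat -> Type :=
| TOne : term 1
| TGen of V : term k
| TComp m n p of (m + n)%N = p.+1 & 'I_m & term m & term n : term p
| TZero n : term n
| TAdd n of term n & term n : term n
| TScale n of K & term n : term n.

Fixpoint teval (P : nsOperad K) (f : V -> P k) n (t : term n) : P n :=
  match t with
  | TOne => nso_one P
  | TGen v => f v
  | TComp _ _ _ e i s t => nso_comp P e i (teval f s) (teval f t)
  | TZero _ => 0
  | TAdd _ s t => teval f s + teval f t
  | TScale _ a t => a *: teval f t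
  end.

Definition teq n (s t : term n) : Prop :=
  forall (P : nsOperad K) (f : {linear V -> P k}), teval f s = teval f t.

HB.instance Definition _ n := gen_eqMixin (term n).
HB.instance Definition _ n := gen_choiceMixin (term n).

Definition teqb n (s t : term n) : bool := `[< teq s t >].
Lemma teqb_refl n : reflexive (@teqb n).
Proof. by move=> s; apply/asboolP. Qed.
Lemma teqb_sym n : symmetric (@teqb n).
Proof. by move=> s t; apply/asboolP/asboolP=> h P f; rewrite h. Qed.
Lemma teqb_trans n : transitive (@teqb n).
Proof. by move=> t s u /asboolP h /asboolP h'; apply/asboolP=> P f; rewrite h. Qed.
Canonical teq_rel n := EquivRel (@teqb n) (@teqb_refl n) (@teqb_sym n) (@teqb_trans n).

Definition free_sort n : Type := {eq_quot (@teqb n)}.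
HB.instance Definition _ n := Choice.on (free_sort n).
HB.instance Definition _ n := EqQuotient.on (free_sort n).
Definition fcls n (t : term n) : free_sort n := \pi t.

Lemma fclsP n (s t : term n) : fcls s = fcls t <-> teq s t.
Proof. by split=> [/eqmodP/asboolP//|h]; apply/eqmodP/asboolP. Qed.
Lemma fclsW n (S : free_sort n -> Prop) : (forall t, S (fcls t)) -> forall x, S x.
Proof. by move=> h x; rewrite -[x]reprK; apply: h. Qed.
Lemma frep n (t : term n) : teq (repr (fcls t)) t.
Proof. by apply/fclsP; rewrite /fcls reprK. Qed.

Definition fadd n (x y : free_sort n) := fcls (TAdd (repr x) (repr y)).
Definition fscale n a (x : free_sort n) := fcls (TScale a (repr x)).

Lemma faddE n (s t : term n) : fadd (fcls s) (fcls t) = fcls (TAdd s t).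
Proof. by apply/fclsP=> P f /=; rewrite !frep. Qed.
Lemma fscaleE n a (t : term n) : fscale a (fcls t) = fcls (TScale a t).
Proof. by apply/fclsP=> P f /=; rewrite !frep. Qed.

Lemma faddA n : associative (@fadd n).
Proof.
elim/fclsW=> s; elim/fclsW=> t; elim/fclsW=> u; rewrite !faddE.
by apply/fclsP=> P f /=; rewrite addrA.
Qed.
Lemma faddC n : commutative (@fadd n).
Proof.
by elim/fclsW=> s; elim/fclsW=> t; rewrite !faddE; apply/fclsP=> P f /=; rewrite addrC.
Qed.
Lemma fadd0 n : left_id (fcls (TZero n)) (@fadd n).
Proof. by elim/fclsW=> s; rewrite faddE; apply/fclsP=> P f /=; rewrite add0r. Qed.
Lemma faddN n : left_inverse (fcls (TZero n)) (@fscale n (-1)) (@fadd n).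
Proof.
by elim/fclsW=> s; rewrite fscaleE faddE; apply/fclsP=> P f /=; rewrite scaleN1r addNr.
Qed.
HB.instance Definition _ n := GRing.isZmodule.Build (free_sort n)
  (@faddA n) (@faddC n) (@fadd0 n) (@faddN n).

Lemma faddrE n (s t : term n) : fcls s + fcls t = fcls (TAdd s t).
Proof. exact: faddE. Qed.
Lemma fscaleA n a b (x : free_sort n) : fscale a (fscale b x) = fscale (a * b) x.
Proof. by elim/fclsW: x => s; rewrite !fscaleE; apply/fclsP=> P f /=; rewrite scalerA. Qed.
Lemma fscale1 n : left_id 1 (@fscale n).
Proof. by elim/fclsW=> s; rewrite !fscaleE; apply/fclsP=> P f /=; rewrite scale1r. Qed.
Lemma fscaleDr n : right_distributive (@fscale n) +%R.
Proof.
move=> a; elim/fclsW=> s; elim/fclsW=> t; rewrite !(fscaleE, faddrE).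
by apply/fclsP=> P f /=; rewrite scalerDr.
Qed.
Lemma fscaleDl n (x : free_sort n) : {morph (@fscale n)^~ x : a b / a + b}.
Proof.
move=> a b; elim/fclsW: x => s; rewrite !(fscaleE, faddrE).
by apply/fclsP=> P f /=; rewrite scalerDl.
Qed.
HB.instance Definition _ n := GRing.Zmodule_isLmodule.Build K (free_sort n)
  (@fscaleA n) (@fscale1 n) (@fscaleDr n) (@fscaleDl n).

Lemma fscalerE n a (t : term n) : a *: fcls t = fcls (TScale a t).
Proof. exact: fscaleE. Qed.

Definition fcomp m n p (e : (m + n)%N = p.+1) (i : 'I_m)
    (x : free_sort m) (y : free_sort n) : free_sort p :=
  fcls (TComp e i (repr x) (repr y)).

Lemma fcompE m n p (e : (m + n)%N = p.+1) (i : 'I_m) s t :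
  fcomp e i (fcls s) (fcls t) = fcls (TComp e i s t).
Proof. by apply/fclsP=> P f /=; rewrite !frep. Qed.

Fact free_bilin m n p (e : (m + n)%N = p.+1) (i : 'I_m) : bilin (fcomp e i).
Proof.
split=> [+ a|+ a]; elim/fclsW=> s; elim/fclsW=> t;
    elim/fclsW=> u; rewrite [a *: fcls t]fscalerE.
  rewrite [X in fcomp _ _ _ X]faddrE !fcompE [a *: fcls _]fscalerE [RHS]faddrE.
  by apply/fclsP=> P f /=; rewrite (nso_bilin e i).1.
rewrite [X in fcomp _ _ X _]faddrE !fcompE [a *: fcls _]fscalerE [RHS]faddrE.
by apply/fclsP=> P f /=; rewrite ((nso_bilin e i).2 (teval f s)).
Qed.
Fact free_comp1 m (e : (m + 1)%N = m.+1) (i : 'I_m) x :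
  fcomp e i x (fcls TOne) = x.
Proof.
elim/fclsW: x => s; rewrite fcompE.
by apply/fclsP=> P f /=; rewrite nso_comp1.
Qed.
Fact free_1comp m (e : (1 + m)%N = m.+1) (i : 'I_1) x :
  fcomp e i (fcls TOne) x = x.
Proof.
elim/fclsW: x => s; rewrite fcompE.
by apply/fclsP=> P f /=; rewrite nso_1comp.
Qed.
Fact free_seq m n l p q r (e1 : (m + n)%N = p.+1) (e2 : (p + l)%N = r.+1)
    (e3 : (n + l)%N = q.+1) (e4 : (m + q)%N = r.+1)
    (i : 'I_m) (j : 'I_n) (h : 'I_p) x y z :
  h = (i + j)%N :> nat ->
  fcomp e2 h (fcomp e1 i x y) z = fcomp e4 i x (fcomp e3 j y z).
Proof.
move: x y z; elim/fclsW=> s; elim/fclsW=> t; elim/fclsW=> u eh; rewrite !fcompE.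
by apply/fclsP=> P f /=; apply: nso_seq.
Qed.
Fact free_par m n l p q r (e1 : (m + n)%N = p.+1) (e2 : (p + l)%N = r.+1)
    (e3 : (m + l)%N = q.+1) (e4 : (q + n)%N = r.+1)
    (i j : 'I_m) (i' : 'I_q) (j' : 'I_p) x y z :
  (i < j)%N -> i' = i :> nat -> j'.+1 = (j + n)%N :> nat ->
  fcomp e2 j' (fcomp e1 i x y) z = fcomp e4 i' (fcomp e3 j x z) y.
Proof.
move: x y z; elim/fclsW=> s; elim/fclsW=> t; elim/fclsW=> u lij ei ej.
by rewrite !fcompE; apply/fclsP=> P f /=; apply: nso_par lij ei ej.
Qed.

Definition free_operad : nsOperad K :=
  @NsOperad K (fun n => free_sort n : lmodType K) (fcls TOne) fcomp
    free_bilin free_comp1 free_1comp free_seq free_par.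

Definition free_gen (v : V) : free_operad k := fcls (TGen v).

Lemma free_gen_linear : linear free_gen.
Proof.
move=> a u v; rewrite /free_gen [a *: fcls _]fscalerE [RHS]faddrE.
by apply/fclsP=> P f /=; rewrite linearP.
Qed.
HB.instance Definition _ :=
  GRing.isLinear.Build K V (free_operad k) _ free_gen free_gen_linear.

Section Lift.
Variables (P : nsOperad K) (f : {linear V -> P k}).
Definition free_lift_map n (x : free_operad n) : P n := teval f (repr x).
Lemma free_lift_mapE n (t : term n) : @free_lift_map n (fcls t) = teval f t.
Proof. exact: frep. Qed.

Fact free_lift_linear n : linear (@free_lift_map n).
Proof.
move=> a; elim/fclsW=> s; elim/fclsW=> t.
by rewrite [_ *: fcls _]fscalerE [X in free_lift_map X]faddrE !free_lift_mapE.
Qed.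
Fact free_lift_one : free_lift_map (nso_one free_operad) = nso_one P.
Proof. exact: free_lift_mapE. Qed.
Fact free_lift_comp m n p (e : (m + n)%N = p.+1) (i : 'I_m) x y :
  free_lift_map (nso_comp free_operad e i x y) =
  nso_comp P e i (free_lift_map x) (free_lift_map y).
Proof.
move: x y; elim/fclsW=> s; elim/fclsW=> t.
by rewrite [X in free_lift_map X]fcompE !free_lift_mapE.
Qed.

Definition free_lift : nsHom free_operad P :=
  NsHom free_lift_linear free_lift_one free_lift_comp.

Lemma free_lift_gen v : free_lift k (free_gen v) = f v.
Proof. exact: free_lift_mapE. Qed.

Lemma free_lift_unique (g : nsHom free_operad P) :
  (forall v, g k (free_gen v) = f v) -> forall n x, g n x = free_lift n x.
Proof.
move=> hg n; elim/fclsW=> t; rewrite [RHS]free_lift_mapE.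
elim: t => /= [|v|m l p e i s IHs t IHt|m|m s IHs t IHt|m a t IHt].
- exact: nsh_one.
- exact: hg.
- by rewrite -fcompE -IHs -IHt; apply: (nsh_comp g).
- exact: (linear0 (@nsh_map _ _ _ g m)).
- by rewrite -faddrE -IHs -IHt; apply: (linearD (@nsh_map _ _ _ g m)).
- by rewrite -fscalerE -IHt; apply: (linearZZ (@nsh_map _ _ _ g m)).
Qed.
End Lift.
End Free.

Record nsIdeal (K : fieldType) (P : nsOperad K) := NsIdeal {
  ideal_mem :> forall n, P n -> Prop;
  ideal0 : forall n, ideal_mem (0 : P n);
  idealP : forall n (a : K) (x y : P n),
    ideal_mem x -> ideal_mem y -> ideal_mem (a *: x + y);
  ideal_compl : forall m n p (e : (m + n)%N = p.+1) (i : 'I_m) x y,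
    ideal_mem x -> ideal_mem (nso_comp P e i x y);
  ideal_compr : forall m n p (e : (m + n)%N = p.+1) (i : 'I_m) x y,
    ideal_mem y -> ideal_mem (nso_comp P e i x y)
}.

Section GenIdeal.
Variables (K : fieldType) (P : nsOperad K) (X : forall n, P n -> Prop).

Definition gen_ideal_mem n (x : P n) : Prop :=
  forall I : nsIdeal P, (forall m y, @X m y -> I m y) -> I n x.
Fact gen_ideal0 n : gen_ideal_mem (0 : P n).
Proof. by move=> I _; apply: ideal0. Qed.
Fact gen_idealP n (a : K) (x y : P n) :
  gen_ideal_mem x -> gen_ideal_mem y -> gen_ideal_mem (a *: x + y).
Proof. by move=> hx hy I hI; apply: idealP; [apply: hx|apply: hy]. Qed.
Fact gen_ideal_compl m n p (e : (m + n)%N = p.+1) (i : 'I_m) x y :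
  gen_ideal_mem x -> gen_ideal_mem (nso_comp P e i x y).
Proof. by move=> hx I hI; apply: ideal_compl; apply: hx. Qed.
Fact gen_ideal_compr m n p (e : (m + n)%N = p.+1) (i : 'I_m) x y :
  gen_ideal_mem y -> gen_ideal_mem (nso_comp P e i x y).
Proof. by move=> hx I hI; apply: ideal_compr; apply: hx. Qed.

Definition gen_ideal : nsIdeal P :=
  NsIdeal gen_ideal0 gen_idealP gen_ideal_compl gen_ideal_compr.
End GenIdeal.

Section Kernel.
Variables (K : fieldType) (P Q : nsOperad K) (f : nsHom P Q).

Definition ker_mem n (x : P n) : Prop := f n x = 0.
Fact ker0 n : ker_mem (0 : P n).
Proof. exact: linear0. Qed.
Fact kerP n (a : K) (x y : P n) : ker_mem x -> ker_mem y -> ker_mem (a *: x + y).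
Proof. by move=> hx hy; rewrite /ker_mem nsh_linear hx hy scaler0 addr0. Qed.
Fact ker_compl m n p (e : (m + n)%N = p.+1) (i : 'I_m) x y :
  ker_mem x -> ker_mem (nso_comp P e i x y).
Proof. by move=> hx; rewrite /ker_mem nsh_comp hx (bilin0l (nso_bilin e i)). Qed.
Fact ker_compr m n p (e : (m + n)%N = p.+1) (i : 'I_m) x y :
  ker_mem y -> ker_mem (nso_comp P e i x y).
Proof. by move=> hx; rewrite /ker_mem nsh_comp hx (bilin0r (nso_bilin e i)). Qed.

Definition nsKer : nsIdeal P := NsIdeal ker0 kerP ker_compl ker_compr.
End Kernel.

Section Quotient.
Variables (K : fieldType) (P : nsOperad K) (I : nsIdeal P).

Lemma idealB n (x y : P n) : I n x -> I n y -> I n (x - y).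
Proof. by move=> hx hy; rewrite addrC -scaleN1r; apply: idealP. Qed.
Lemma idealN n (x : P n) : I n x -> I n (- x).
Proof. by move=> hx; rewrite -sub0r; apply: idealB => //; apply: ideal0. Qed.
Lemma idealD n (x y : P n) : I n x -> I n y -> I n (x + y).
Proof. by move=> hx hy; rewrite -[x]scale1r; apply: idealP. Qed.
Lemma idealZ n a (x : P n) : I n x -> I n (a *: x).
Proof. by move=> hx; rewrite -[_ *: _]addr0; apply: idealP => //; apply: ideal0. Qed.

Definition qeqb n (x y : P n) : bool := `[< I n (x - y) >].
Lemma qeqb_refl n : reflexive (@qeqb n).
Proof. by move=> s; apply/asboolP; rewrite subrr; apply: ideal0. Qed.
Lemma qeqb_sym n : symmetric (@qeqb n).
Proof. by move=> s t; apply/asboolP/asboolP=> /idealN; rewrite opprB. Qed.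
Lemma qeqb_trans n : transitive (@qeqb n).
Proof.
move=> t s u /asboolP h /asboolP h'; apply/asboolP.
by have := idealD h h'; rewrite addrA subrK.
Qed.
Canonical qeq_rel n := EquivRel (@qeqb n) (@qeqb_refl n) (@qeqb_sym n) (@qeqb_trans n).

Definition quot_sort n : Type := {eq_quot (@qeqb n)}.
HB.instance Definition _ n := Choice.on (quot_sort n).
HB.instance Definition _ n := EqQuotient.on (quot_sort n).
Definition qcls n (x : P n) : quot_sort n := \pi x.

Lemma qclsP n (x y : P n) : qcls x = qcls y <-> I n (x - y).
Proof. by split=> [/eqmodP/asboolP//|h]; apply/eqmodP/asboolP. Qed.
Lemma qclsW n (S : quot_sort n -> Prop) : (forall t, S (qcls t)) -> forall x, S x.
Proof. by move=> h x; rewrite -[x]reprK; apply: h. Qed.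
Lemma qrep n (x : P n) : I n (repr (qcls x) - x).
Proof. by apply/qclsP; rewrite /qcls reprK. Qed.

Definition qadd n (x y : quot_sort n) := qcls (repr x + repr y).
Definition qopp n (x : quot_sort n) := qcls (- repr x).
Definition qscale n a (x : quot_sort n) := qcls (a *: repr x).

Lemma qaddE n (s t : P n) : qadd (qcls s) (qcls t) = qcls (s + t).
Proof. by apply/qclsP; rewrite opprD addrACA; apply: idealD; apply: qrep. Qed.
Lemma qoppE n (t : P n) : qopp (qcls t) = qcls (- t).
Proof. by apply/qclsP; rewrite -opprD; apply/idealN/qrep. Qed.
Lemma qscaleE n a (t : P n) : qscale a (qcls t) = qcls (a *: t).
Proof. by apply/qclsP; rewrite -scalerBr; apply/idealZ/qrep. Qed.

Lemma qaddA n : associative (@qadd n).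
Proof.
by elim/qclsW=> s; elim/qclsW=> t; elim/qclsW=> u; rewrite !qaddE addrA.
Qed.
Lemma qaddC n : commutative (@qadd n).
Proof. by elim/qclsW=> s; elim/qclsW=> t; rewrite !qaddE addrC. Qed.
Lemma qadd0 n : left_id (qcls (0 : P n)) (@qadd n).
Proof. by elim/qclsW=> s; rewrite qaddE add0r. Qed.
Lemma qaddN n : left_inverse (qcls (0 : P n)) (@qopp n) (@qadd n).
Proof. by elim/qclsW=> s; rewrite qoppE qaddE addNr. Qed.
HB.instance Definition _ n := GRing.isZmodule.Build (quot_sort n)
  (@qaddA n) (@qaddC n) (@qadd0 n) (@qaddN n).

Lemma qaddrE n (s t : P n) : qcls s + qcls t = qcls (s + t).
Proof. exact: qaddE. Qed.
Lemma qscaleA n a b (x : quot_sort n) : qscale a (qscale b x) = qscale (a * b) x.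
Proof. by elim/qclsW: x => s; rewrite !qscaleE scalerA. Qed.
Lemma qscale1 n : left_id 1 (@qscale n).
Proof. by elim/qclsW=> s; rewrite !qscaleE scale1r. Qed.
Lemma qscaleDr n : right_distributive (@qscale n) +%R.
Proof.
by move=> a; elim/qclsW=> s; elim/qclsW=> t; rewrite !(qscaleE, qaddrE) scalerDr.
Qed.
Lemma qscaleDl n (x : quot_sort n) : {morph (@qscale n)^~ x : a b / a + b}.
Proof. by move=> a b; elim/qclsW: x => s; rewrite !(qscaleE, qaddrE) scalerDl. Qed.
HB.instance Definition _ n := GRing.Zmodule_isLmodule.Build K (quot_sort n)
  (@qscaleA n) (@qscale1 n) (@qscaleDr n) (@qscaleDl n).

Lemma qscalerE n a (t : P n) : a *: qcls t = qcls (a *: t).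
Proof. exact: qscaleE. Qed.

Definition qcomp m n p (e : (m + n)%N = p.+1) (i : 'I_m)
    (x : quot_sort m) (y : quot_sort n) : quot_sort p :=
  qcls (nso_comp P e i (repr x) (repr y)).

Lemma qcompE m n p (e : (m + n)%N = p.+1) (i : 'I_m) s t :
  qcomp e i (qcls s) (qcls t) = qcls (nso_comp P e i s t).
Proof.
apply/qclsP; set s' := repr _; set t' := repr _.
have -> : nso_comp P e i s' t' - nso_comp P e i s t =
    nso_comp P e i (s' - s) t' + nso_comp P e i s (t' - t).
  by rewrite (bilinBl (nso_bilin e i)) (bilinBr (nso_bilin e i)) addrA subrK.
apply: idealD; first exact/ideal_compl/qrep.
exact/ideal_compr/qrep.
Qed.

Fact quot_bilin m n p (e : (m + n)%N = p.+1) (i : 'I_m) : bilin (qcomp e i).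
Proof.
split=> [+ a|+ a]; elim/qclsW=> s; elim/qclsW=> t;
    elim/qclsW=> u; rewrite [a *: qcls t]qscalerE.
  rewrite [X in qcomp _ _ _ X]qaddrE !qcompE [a *: qcls _]qscalerE [RHS]qaddrE.
  by rewrite (nso_bilin e i).1.
rewrite [X in qcomp _ _ X _]qaddrE !qcompE [a *: qcls _]qscalerE [RHS]qaddrE.
by rewrite ((nso_bilin e i).2 s).
Qed.
Fact quot_comp1 m (e : (m + 1)%N = m.+1) (i : 'I_m) x :
  qcomp e i x (qcls (nso_one P)) = x.
Proof. by elim/qclsW: x => s; rewrite qcompE nso_comp1. Qed.
Fact quot_1comp m (e : (1 + m)%N = m.+1) (i : 'I_1) x :
  qcomp e i (qcls (nso_one P)) x = x.
Proof. by elim/qclsW: x => s; rewrite qcompE nso_1comp. Qed.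
Fact quot_seq m n l p q r (e1 : (m + n)%N = p.+1) (e2 : (p + l)%N = r.+1)
    (e3 : (n + l)%N = q.+1) (e4 : (m + q)%N = r.+1)
    (i : 'I_m) (j : 'I_n) (h : 'I_p) x y z :
  h = (i + j)%N :> nat ->
  qcomp e2 h (qcomp e1 i x y) z = qcomp e4 i x (qcomp e3 j y z).
Proof.
move: x y z; elim/qclsW=> s; elim/qclsW=> t; elim/qclsW=> u eh.
by rewrite !qcompE (nso_seq e1 e2 e3 e4 s t u eh).
Qed.
Fact quot_par m n l p q r (e1 : (m + n)%N = p.+1) (e2 : (p + l)%N = r.+1)
    (e3 : (m + l)%N = q.+1) (e4 : (q + n)%N = r.+1)
    (i j : 'I_m) (i' : 'I_q) (j' : 'I_p) x y z :
  (i < j)%N -> i' = i :> nat -> j'.+1 = (j + n)%N :> nat ->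
  qcomp e2 j' (qcomp e1 i x y) z = qcomp e4 i' (qcomp e3 j x z) y.
Proof.
move: x y z; elim/qclsW=> s; elim/qclsW=> t; elim/qclsW=> u lij ei ej.
by rewrite !qcompE (nso_par e1 e2 e3 e4 s t u lij ei ej).
Qed.

Definition quot_operad : nsOperad K :=
  @NsOperad K (fun n => quot_sort n : lmodType K) (qcls (nso_one P)) qcomp
    quot_bilin quot_comp1 quot_1comp quot_seq quot_par.

Definition quot_proj_map n (x : P n) : quot_operad n := qcls x.
Fact quot_proj_linear n : linear (@quot_proj_map n).
Proof. by move=> a x y; rewrite [_ *: quot_proj_map _]qscalerE [RHS]qaddrE. Qed.
Fact quot_proj_one : quot_proj_map (nso_one P) = nso_one quot_operad.
Proof. by []. Qed.
Fact quot_proj_comp m n p (e : (m + n)%N = p.+1) (i : 'I_m) x y :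
  quot_proj_map (nso_comp P e i x y) =
  nso_comp quot_operad e i (quot_proj_map x) (quot_proj_map y).
Proof. by rewrite [RHS]qcompE. Qed.

Definition quot_proj : nsHom P quot_operad :=
  NsHom quot_proj_linear quot_proj_one quot_proj_comp.

Lemma quot_proj0 n (x : P n) : quot_proj n x = 0 <-> I n x.
Proof. by rewrite -[x in I n x]subr0 -qclsP. Qed.

Section Lift.
Variables (Q : nsOperad K) (f : nsHom P Q).
Hypothesis hf : forall n (x : P n), I n x -> f n x = 0.
Definition quot_lift_map n (x : quot_operad n) : Q n := f n (repr x).
Lemma quot_lift_mapE n (x : P n) : @quot_lift_map n (qcls x) = f n x.
Proof.
apply/eqP; rewrite -subr_eq0 -(linearB (@nsh_map _ _ _ f n)).
by apply/eqP/hf/qrep.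
Qed.
Fact quot_lift_linear n : linear (@quot_lift_map n).
Proof.
move=> a; elim/qclsW=> s; elim/qclsW=> t.
rewrite [_ *: qcls _]qscalerE [X in quot_lift_map X]qaddrE !quot_lift_mapE.
exact: nsh_linear.
Qed.
Fact quot_lift_one : quot_lift_map (nso_one quot_operad) = nso_one Q.
Proof. by rewrite [LHS]quot_lift_mapE; apply: nsh_one. Qed.
Fact quot_lift_comp m n p (e : (m + n)%N = p.+1) (i : 'I_m) x y :
  quot_lift_map (nso_comp quot_operad e i x y) =
  nso_comp Q e i (quot_lift_map x) (quot_lift_map y).
Proof.
move: x y; elim/qclsW=> s; elim/qclsW=> t.
by rewrite [X in quot_lift_map X]qcompE !quot_lift_mapE; apply: nsh_comp.
Qed.

Definition quot_lift : nsHom quot_operad Q :=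
  NsHom quot_lift_linear quot_lift_one quot_lift_comp.
Lemma quot_lift_proj n (x : P n) : quot_lift n (quot_proj n x) = f n x.
Proof. exact: quot_lift_mapE. Qed.
End Lift.
End Quotient.

Section PermInsertion.

Definition pnat n (s : 'S_n) (c : nat) : nat := oapp (fun i : 'I_n => val (s i)) c (insub c).

Lemma pnatE n (s : 'S_n) (i : 'I_n) : pnat s i = s i.
Proof. by rewrite /pnat valK. Qed.
Lemma pnat_lt n (s : 'S_n) c : (c < n)%N -> (pnat s c < n)%N.
Proof. by move=> h; rewrite -[c]/(val (Ordinal h)) pnatE. Qed.
Lemma pnat_inj n (s : 'S_n) c d : (c < n)%N -> (d < n)%N -> pnat s c = pnat s d -> c = d.
Proof.
move=> hc hd; rewrite -[c]/(val (Ordinal hc)) -[d]/(val (Ordinal hd)) !pnatE.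
by move=> /val_inj/perm_inj ->.
Qed.
Lemma pnat_neq n (s : 'S_n) c d :
  (c < n)%N -> (d < n)%N -> c <> d -> pnat s c <> pnat s d.
Proof. by move=> hc hd h /(pnat_inj hc hd). Qed.
Lemma pnat1 n c : pnat (1%g : 'S_n) c = c.
Proof. by rewrite /pnat; case: insubP => [i _ <-|//] /=; rewrite perm1. Qed.
Lemma pnatM n (s t : 'S_n) c : (c < n)%N -> pnat (s * t)%g c = pnat t (pnat s c).
Proof. by move=> h; rewrite -[c]/(val (Ordinal h)) !pnatE permM. Qed.

Definition shift n a c : nat := if (c < a)%N then c else (c + n).-1.

Definition insn n (s t : nat -> nat) a c : nat :=
  if (c < a)%N then shift n (s a) (s c) else
  if (c < a + n)%N then (s a + t (c - a))%N else shift n (s a) (s (c.+1 - n)%N).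

Lemma insn_in n s t a d : (d < n)%N -> insn n s t a (a + d) = (s a + t d)%N.
Proof. by move=> h; rewrite /insn ifN ?ltn_add2l ?h ?addKn //; lia. Qed.

Lemma insn_out n s t a d : d <> a ->
  insn n s t a (shift n a d) = shift n (s a) (s d).
Proof.
move=> h; rewrite {1}/shift; case: (ltnP d a) => h1; rewrite /insn ?h1 //.
rewrite ifN; last lia.
by rewrite ifN; last lia; congr (shift _ _ (s _)); lia.
Qed.

Variant pos_spec m n a : nat -> Prop :=
| PosIn d of (d < n)%N : pos_spec m n a (a + d)
| PosOut d of (d < m)%N & d <> a : pos_spec m n a (shift n a d).

Lemma posP m n p a c : (m + n)%N = p.+1 -> (a < m)%N -> (c < p)%N ->
  pos_spec m n a c.
Proof.
move=> e ha hc; case: (ltnP c a) => c1.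
  have -> : c = shift n a c by rewrite /shift c1.
  by constructor; lia.
case: (ltnP c (a + n)) => c2.
  have -> : c = (a + (c - a))%N by lia.
  by constructor; lia.
have -> : c = shift n a (c.+1 - n)%N by rewrite /shift; case: ifP; lia.
by constructor; lia.
Qed.

Lemma shift_lt m n p a c : (m + n)%N = p.+1 -> (a < m)%N -> (c < m)%N ->
  c <> a -> (shift n a c < p)%N.
Proof. by rewrite /shift; case: ifP; lia. Qed.

Lemma shift_inj n a c d : c <> a -> d <> a -> shift n a c = shift n a d -> c = d.
Proof. by rewrite /shift; do 2!case: ifP; lia. Qed.

Lemma shift_neq n a c d : c <> a -> (d < n)%N -> shift n a c <> (a + d)%N.
Proof. by rewrite /shift; case: ifP; lia. Qed.

Variables (m n p : nat) (e : (m + n)%N = p.+1).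

Lemma insn_lt (s : 'S_m) (t : 'S_n) (a : 'I_m) c :
  (c < p)%N -> (insn n (pnat s) (pnat t) a c < p)%N.
Proof.
have ha := ltn_ord a; have hsa := pnat_lt s ha.
move=> /(posP e ha)[d hd|d hd ne].
  by rewrite insn_in //; have := pnat_lt t hd; lia.
rewrite insn_out //; apply: (shift_lt e) => //; first exact: pnat_lt.
exact: pnat_neq.
Qed.

Lemma insn_inj (s : 'S_m) (t : 'S_n) (a : 'I_m) c d :
  (c < p)%N -> (d < p)%N ->
  insn n (pnat s) (pnat t) a c = insn n (pnat s) (pnat t) a d -> c = d.
Proof.
have ha := ltn_ord a; have nea c' hc' := @pnat_neq _ s c' a hc' ha.
move=> /(posP e ha)[{}c hc|{}c hc nc] /(posP e ha)[{}d hd|{}d hd nd].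
- by rewrite !insn_in // => /addnI/pnat_inj ->.
- rewrite insn_in // insn_out // => /esym.
  by move=> h; case: (shift_neq (nea _ hd nd) (pnat_lt t hc) h).
- rewrite insn_in // insn_out // => h.
  by case: (shift_neq (nea _ hc nc) (pnat_lt t hd) h).
- by rewrite !insn_out // => /shift_inj h; congr (shift _ _ _); apply: (@pnat_inj _ s) => //; apply: h; apply: nea.
Qed.

Definition pcirc_fun (s : 'S_m) (t : 'S_n) (a : 'I_m) (c : 'I_p) : 'I_p :=
  Ordinal (insn_lt s t a (ltn_ord c)).

Lemma pcirc_fun_inj s t a : injective (pcirc_fun s t a).
Proof. by move=> c d [/insn_inj h]; apply: val_inj; apply: h. Qed.

Definition pcirc s t a : 'S_p := perm (@pcirc_fun_inj s t a).

Lemma pcircE s t (a : 'I_m) c : (c < p)%N ->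
  pnat (pcirc s t a) c = insn n (pnat s) (pnat t) a c.
Proof. by move=> h; rewrite -[c in LHS]/(val (Ordinal h)) pnatE permE. Qed.

End PermInsertion.

Lemma perm_pnat n (s t : 'S_n) : (forall c, (c < n)%N -> pnat s c = pnat t c) -> s = t.
Proof. by move=> h; apply/permP=> i; apply: val_inj; rewrite /= -!pnatE h. Qed.

Lemma pcirc_in m n p (e : (m + n)%N = p.+1) (s : 'S_m) (t : 'S_n) (a : 'I_m) d :
  (d < n)%N -> pnat (pcirc e s t a) (a + d) = (pnat s a + pnat t d)%N.
Proof. by move=> hd; have ha := ltn_ord a; rewrite pcircE ?insn_in //; lia. Qed.

Lemma pcirc_out m n p (e : (m + n)%N = p.+1) (s : 'S_m) (t : 'S_n) (a : 'I_m) d :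
  (d < m)%N -> d <> a ->
  pnat (pcirc e s t a) (shift n a d) = shift n (pnat s a) (pnat s d).
Proof.
by move=> hd ne; have ha := ltn_ord a; rewrite pcircE ?insn_out //; apply: (shift_lt e).
Qed.

Lemma pcirc1r m (e : (m + 1)%N = m.+1) (s : 'S_m) a : pcirc e s 1%g a = s.
Proof.
have sh1 x y : shift 1 x y = y by rewrite /shift; case: ifP; lia.
apply: perm_pnat => c /(posP e (ltn_ord a))[d hd|d hd ne].
  by rewrite pcirc_in // pnat1; have -> : d = 0%N; [lia|rewrite !addn0].
by rewrite pcirc_out // !sh1.
Qed.

Lemma pcirc1l m (e : (1 + m)%N = m.+1) (t : 'S_m) a : pcirc e 1%g t a = t.
Proof.
apply: perm_pnat => c /(posP e (ltn_ord a))[d hd|d hd ne].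
  by rewrite pcirc_in // pnat1 [a]ord1.
by have := ltn_ord a; lia.
Qed.

Lemma pcircM m n p (e : (m + n)%N = p.+1) (s s' : 'S_m) (t t' : 'S_n) a :
  pcirc e (s * s')%g (t * t')%g a = (pcirc e s t a * pcirc e s' t' (s a))%g.
Proof.
have ha := ltn_ord a; apply: perm_pnat => c hc; rewrite pnatM //.
move: hc => /(posP e ha)[d hd|d hd ne].
  by rewrite !pcirc_in // !pnatM // pnatE pcirc_in //; apply: pnat_lt.
rewrite !pcirc_out // !pnatM // pnatE pcirc_out //; first exact: pnat_lt.
by rewrite -pnatE; apply: pnat_neq.
Qed.

Lemma pcirc_seq m n l p q r (e1 : (m + n)%N = p.+1) (e2 : (p + l)%N = r.+1)
      (e3 : (n + l)%N = q.+1) (e4 : (m + q)%N = r.+1)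
      (s : 'S_m) (t : 'S_n) (u : 'S_l) (a : 'I_m) (b : 'I_n) (h : 'I_p) :
  h = (a + b)%N :> nat ->
  pcirc e2 (pcirc e1 s t a) u h = pcirc e4 s (pcirc e3 t u b) a.
Proof.
have ha := ltn_ord a; have hb := ltn_ord b => eh.
have eph : pnat (pcirc e1 s t a) h = (pnat s a + pnat t b)%N.
  by rewrite eh pcirc_in.
have sh1 x y z : (x + shift l y z)%N = shift l (x + y) (x + z) \/ z = y.
  by rewrite /shift; do 2!case: ifP; lia.
have sh2 x y z : (y < n)%N -> z <> x ->
    shift q x z = shift l (x + y) (shift n x z).
  by rewrite /shift; do ?case: ifP; lia.
apply: perm_pnat => c hc; case: (posP e4 ha hc) => [d hd|d hd ne].
  rewrite pcirc_in //; case: (posP e3 hb hd) => [f hf|f hf nf].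
    by rewrite addnA -eh !pcirc_in // eph addnA.
  rewrite pcirc_out //.
  case: (sh1 a b f) => [->|//]; rewrite -eh.
  rewrite pcirc_out ?eh; [|lia|lia].
  rewrite -eh eph pcirc_in //.
  by case: (sh1 (pnat s a) (pnat t b) (pnat t f)) => // /pnat_inj; lia.
rewrite pcirc_out // (sh2 _ b) // -eh pcirc_out.
- rewrite eph pcirc_out // (sh2 _ (pnat t b)) //; first exact: pnat_lt.
  exact: pnat_neq.
- exact: (shift_lt e1).
- by rewrite eh; apply: shift_neq.
Qed.

Lemma pcirc_par m n l p q r (e1 : (m + n)%N = p.+1) (e2 : (p + l)%N = r.+1)
      (e3 : (m + l)%N = q.+1) (e4 : (q + n)%N = r.+1)
      (s : 'S_m) (t : 'S_n) (u : 'S_l) (a b : 'I_m) (a' : 'I_q) (b' : 'I_p) :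
  a <> b -> b' = shift n a b :> nat -> a' = shift l b a :> nat ->
  pcirc e2 (pcirc e1 s t a) u b' = pcirc e4 (pcirc e3 s u b) t a'.
Proof.
have ha := ltn_ord a; have hb := ltn_ord b => nab eb ea.
have nab' : (a : nat) <> b by move=> /val_inj.
have nba' : (b : nat) <> a by move=> /val_inj/esym.
have nsab : pnat s a <> pnat s b by apply: pnat_neq.
have epb : pnat (pcirc e1 s t a) b' = shift n (pnat s a) (pnat s b).
  by rewrite eb pcirc_out.
have epa : pnat (pcirc e3 s u b) a' = shift l (pnat s b) (pnat s a).
  by rewrite ea pcirc_out.
have sh1 x y z : x <> y -> z <> x -> z <> y ->
    shift l (shift n x y) (shift n x z) = shift n (shift l y x) (shift l y z).
  by rewrite /shift; do ?case: ifP; lia.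
have sh2 x y d : x <> y -> (d < n)%N ->
    (shift l y x + d)%N = shift l (shift n x y) (x + d).
  by rewrite /shift; do ?case: ifP; lia.
have sh3 x y d : x <> y -> (d < l)%N ->
    (shift n x y + d)%N = shift n (shift l y x) (y + d).
  by rewrite /shift; do ?case: ifP; lia.
have ha' := ltn_ord a'.
apply: perm_pnat => c hc; case: (posP e4 ha' hc) => [d hd|d hd ne].
  rewrite pcirc_in // epa ea sh2 // -eb pcirc_out.
  - by rewrite epb pcirc_in // sh2 //; apply: pnat_lt.
  - lia.
  - by rewrite eb => /esym; apply: shift_neq.
rewrite pcirc_out // epa; case: (posP e3 hb hd) ne => [f hf|f hf nf] ne.
  rewrite pcirc_in // ea -sh3 // -eb pcirc_in // epb sh3 //.
  exact: pnat_lt.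
have nfa : f <> a by move=> fa; apply: ne; rewrite ea fa.
rewrite pcirc_out // ea -sh1 // -eb pcirc_out.
- rewrite epb pcirc_out // sh1 //; exact: pnat_neq.
- exact: (shift_lt e1).
- by rewrite eb => /shift_inj; apply: contra_not nf; apply.
Qed.

Record operad (K : fieldType) := Operad {
  opd_ns :> nsOperad K;
  opd_act : forall n, opd_ns n -> 'S_n -> opd_ns n;
  opd_act_linear : forall n (s : 'S_n), linear ((@opd_act n)^~ s);
  opd_act1 : forall n (x : opd_ns n), opd_act x 1%g = x;
  opd_actM : forall n (x : opd_ns n) (s t : 'S_n),
    opd_act x (s * t)%g = opd_act (opd_act x s) t;
  opd_equivariant : forall m n p (e : (m + n)%N = p.+1) (i : 'I_m)
      (s : 'S_m) (t : 'S_n) x y,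
    nso_comp opd_ns e (s i) (opd_act x s) (opd_act y t) =
    opd_act (nso_comp opd_ns e i x y) (pcirc e s t i)
}.
Arguments opd_act {K} P {n} x s : rename.

Record opdHom (K : fieldType) (P Q : operad K) := OpdHom {
  opdh_ns :> nsHom P Q;
  opdh_act : forall n (x : P n) (s : 'S_n),
    opdh_ns n (opd_act P x s) = opd_act Q (opdh_ns n x) s
}.

Lemma opdHom_eq K (P Q : operad K) (f g : opdHom P Q) :
  (forall n x, f n x = g n x) -> f = g.
Proof.
case: f g => [[f lf uf cf] af] [[g lg ug cg] ag] /= h.
have e : f = g by apply: functional_extensionality_dep => n; apply/funext.
case: _ / e in lg ug cg ag h *.
have e : NsHom lf uf cf = NsHom lg ug cg by congr NsHom; apply: Prop_irrelevance.
case: _ / e in ag *.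
by congr OpdHom; apply: Prop_irrelevance.
Qed.

Fact opdHom_comp_act K (P Q R : operad K) (g : opdHom Q R) (f : opdHom P Q)
    n (x : P n) (s : 'S_n) :
  nsHom_comp g f n (opd_act P x s) = opd_act R (nsHom_comp g f n x) s.
Proof. by rewrite /= !opdh_act. Qed.
Definition opdHom_comp K (P Q R : operad K) (g : opdHom Q R) (f : opdHom P Q) :
  opdHom P R := OpdHom (opdHom_comp_act g f).

Section Regular.
Variables (K : fieldType) (P : nsOperad K).

Definition reg_sort n : lmodType K := {ffun 'S_n -> P n}.

Definition sing n (s : 'S_n) (u : P n) : reg_sort n :=
  [ffun t => if t == s then u else 0].

Lemma sing_linear n (s : 'S_n) : linear (sing s).
Proof.
move=> a u v; apply/ffunP=> t; rewrite !ffunE; case: eqP => // _.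
by rewrite scaler0 addr0.
Qed.
HB.instance Definition _ n (s : 'S_n) :=
  GRing.isLinear.Build K (P n) (reg_sort n) _ (sing s) (sing_linear s).

Lemma sing_sum n (x : reg_sort n) : x = \sum_s sing s (x s).
Proof.
apply/ffunP=> t; rewrite sum_ffunE (bigD1 t) //= ffunE eqxx big1 ?addr0 //.
by move=> s /negPf; rewrite ffunE eq_sym => ->.
Qed.

Lemma sing_ext n (U : lmodType K) (f g : reg_sort n -> U) :
  linear f -> linear g -> (forall s u, f (sing s u) = g (sing s u)) -> f =1 g.
Proof.
move=> lf lg h x.
pose F : {linear reg_sort n -> U} := HB.pack f (GRing.isLinear.Build _ _ _ _ f lf).
pose G : {linear reg_sort n -> U} := HB.pack g (GRing.isLinear.Build _ _ _ _ g lg).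
rewrite -[f x]/(F x) -[g x]/(G x) (sing_sum x) !linear_sum.
by apply: eq_bigr => s _; apply: h.
Qed.

Definition reg_comp m n p (e : (m + n)%N = p.+1) (i : 'I_m)
    (x : reg_sort m) (y : reg_sort n) : reg_sort p :=
  \sum_s \sum_t sing (pcirc e s t ((s^-1)%g i))
                     (nso_comp P e ((s^-1)%g i) (x s) (y t)).

Lemma reg_bilin m n p (e : (m + n)%N = p.+1) (i : 'I_m) : bilin (reg_comp e i).
Proof.
split=> [x a y z|x a y z]; rewrite /reg_comp scaler_sumr -big_split;
  apply: eq_bigr => s _; rewrite scaler_sumr -big_split; apply: eq_bigr => t _.
  by rewrite !ffunE (nso_bilin e _).1 linearP.
by rewrite !ffunE ((nso_bilin e _).2 (x t)) linearP.
Qed.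

Lemma reg_comp_sing m n p (e : (m + n)%N = p.+1) (i : 'I_m) s t u v :
  reg_comp e i (sing s u) (sing t v) =
  sing (pcirc e s t ((s^-1)%g i)) (nso_comp P e ((s^-1)%g i) u v).
Proof.
rewrite /reg_comp (bigD1 s) //= (bigD1 t) //= !ffunE !eqxx.
rewrite !big1 ?addr0 // => [s' /negPf hs|t' /negPf ht]; last first.
  by rewrite !ffunE ht (bilin0r (nso_bilin _ _)) linear0.
rewrite big1 // => t' _.
by rewrite !ffunE hs (bilin0l (nso_bilin _ _)) linear0.
Qed.

Fact reg_comp1 m (e : (m + 1)%N = m.+1) (i : 'I_m) x :
  reg_comp e i x (sing 1%g (nso_one P)) = x.
Proof.
move: x; apply: sing_ext => [a x y|//|s u].
  by rewrite ((reg_bilin e i).2 _).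
by rewrite reg_comp_sing pcirc1r nso_comp1.
Qed.
Fact reg_1comp m (e : (1 + m)%N = m.+1) (i : 'I_1) x :
  reg_comp e i (sing 1%g (nso_one P)) x = x.
Proof.
move: x; apply: sing_ext => [a x y|//|s u].
  by rewrite (reg_bilin e i).1.
by rewrite reg_comp_sing pcirc1l invg1 perm1 nso_1comp.
Qed.
Fact reg_seq m n l p q r (e1 : (m + n)%N = p.+1) (e2 : (p + l)%N = r.+1)
    (e3 : (n + l)%N = q.+1) (e4 : (m + q)%N = r.+1)
    (i : 'I_m) (j : 'I_n) (h : 'I_p) x y z :
  h = (i + j)%N :> nat ->
  reg_comp e2 h (reg_comp e1 i x y) z = reg_comp e4 i x (reg_comp e3 j y z).
Proof.
move=> eh.
have b1 := reg_bilin e1 i; have b2 := reg_bilin e2 h.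
have b3 := reg_bilin e3 j; have b4 := reg_bilin e4 i.
rewrite (sing_sum x) (bilin_suml b1) (bilin_suml b2) (bilin_suml b4).
apply: eq_bigr => s _.
rewrite (sing_sum y) (bilin_sumr b1) (bilin_suml b2) (bilin_suml b3).
rewrite (bilin_sumr b4); apply: eq_bigr => t _.
rewrite (sing_sum z) (bilin_sumr b2) (bilin_sumr b3) (bilin_sumr b4).
apply: eq_bigr => u _; rewrite !reg_comp_sing.
set a := (s^-1)%g i; set b := (t^-1)%g j.
set h' := ((pcirc e1 s t a)^-1)%g h.
have eh' : h' = (a + b)%N :> nat.
  have ha := ltn_ord a; have hb := ltn_ord b.
  have ab : (a + b < p)%N by lia.
  have -> : h' = Ordinal ab; last by [].
  apply: (@perm_inj _ (pcirc e1 s t a)); rewrite permKV; apply: val_inj.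
  rewrite [LHS]eh -[RHS]pnatE pcirc_in; last exact: ltn_ord.
  by rewrite !pnatE !permKV.
by rewrite (pcirc_seq e1 e2 e3 e4 s t u eh') (nso_seq e1 e2 e3 e4 _ _ _ eh').
Qed.
Fact reg_par m n l p q r (e1 : (m + n)%N = p.+1) (e2 : (p + l)%N = r.+1)
    (e3 : (m + l)%N = q.+1) (e4 : (q + n)%N = r.+1)
    (i j : 'I_m) (i' : 'I_q) (j' : 'I_p) x y z :
  (i < j)%N -> i' = i :> nat -> j'.+1 = (j + n)%N :> nat ->
  reg_comp e2 j' (reg_comp e1 i x y) z = reg_comp e4 i' (reg_comp e3 j x z) y.
Proof.
move=> lij ei ej.
have b1 := reg_bilin e1 i; have b2 := reg_bilin e2 j'.
have b3 := reg_bilin e3 j; have b4 := reg_bilin e4 i'.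
rewrite (sing_sum x) (bilin_suml b1) (bilin_suml b2) (bilin_suml b3).
rewrite (bilin_suml b4); apply: eq_bigr => s _.
rewrite (sing_sum y) (bilin_sumr b1) (bilin_suml b2) (bilin_sumr b4).
apply: eq_bigr => t _.
rewrite (sing_sum z) (bilin_sumr b2) (bilin_sumr b3) (bilin_suml b4).
apply: eq_bigr => u _; rewrite !reg_comp_sing.
set a := (s^-1)%g i; set b := (s^-1)%g j.
set b' := ((pcirc e1 s t a)^-1)%g j'.
set a' := ((pcirc e3 s u b)^-1)%g i'.
have nab : a <> b by move=> /perm_inj ij; rewrite ij ltnn in lij.
have ha := ltn_ord a; have hb := ltn_ord b.
have nab' : (a : nat) <> b by move=> /val_inj.
have eb' : b' = shift n a b :> nat.
  have lb : (shift n a b < p)%N by apply: (shift_lt e1) => //; lia.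
  have -> : b' = Ordinal lb; last by [].
  apply: (@perm_inj _ (pcirc e1 s t a)); rewrite permKV; apply: val_inj.
  rewrite -[RHS]pnatE pcirc_out //; last lia.
  by rewrite !pnatE !permKV /shift /= ifN; lia.
have ea' : a' = shift l b a :> nat.
  have la : (shift l b a < q)%N by apply: (shift_lt e3) => //; lia.
  have -> : a' = Ordinal la; last by [].
  apply: (@perm_inj _ (pcirc e3 s u b)); rewrite permKV; apply: val_inj.
  rewrite -[RHS]pnatE pcirc_out //.
  by rewrite !pnatE !permKV /shift /= ifT; lia.
rewrite (pcirc_par e1 e2 e3 e4 s t u nab eb' ea').
congr (sing _ _); case: (ltngtP a b) => [lab|lab|//].
  apply: (nso_par _ _ _ _ _ _ _ lab); first by rewrite ea' /shift lab.
  by rewrite eb' /shift ltnNge (ltnW lab) /= prednK // (leq_ltn_trans _ (ltn_addr n lab)).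
symmetry; apply: (nso_par _ _ _ _ _ _ _ lab); first by rewrite eb' /shift lab.
by rewrite ea' /shift ltnNge (ltnW lab) /= prednK // (leq_ltn_trans _ (ltn_addr l lab)).
Qed.

Definition reg_ns : nsOperad K :=
  @NsOperad K reg_sort (sing 1%g (nso_one P)) reg_comp
    reg_bilin reg_comp1 reg_1comp reg_seq reg_par.

Definition reg_act n (x : reg_sort n) (r : 'S_n) : reg_sort n :=
  [ffun s => x (s * r^-1)%g].

Lemma reg_act_sing n (s r : 'S_n) u : reg_act (sing s u) r = sing (s * r)%g u.
Proof.
apply/ffunP=> t; rewrite !ffunE; congr (if _ then _ else _).
by apply/eqP/eqP=> [<-|->]; rewrite ?mulgKV ?mulgK.
Qed.

Lemma reg_act_linear n (r : 'S_n) : linear ((@reg_act n)^~ r).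
Proof. by move=> a x y; apply/ffunP=> s; rewrite !ffunE. Qed.
Lemma reg_act_sum n (r : 'S_n) (I : finType) (F : I -> reg_sort n) :
  reg_act (\sum_i F i) r = \sum_i reg_act (F i) r.
Proof.
apply/ffunP=> s; rewrite ffunE !sum_ffunE.
by apply: eq_bigr => i _; rewrite ffunE.
Qed.

Fact reg_act1 n (x : reg_sort n) : reg_act x 1%g = x.
Proof. by apply/ffunP=> s; rewrite ffunE invg1 mulg1. Qed.
Fact reg_actM n (x : reg_sort n) (s t : 'S_n) :
  reg_act x (s * t)%g = reg_act (reg_act x s) t.
Proof. by apply/ffunP=> r; rewrite !ffunE invMg mulgA. Qed.
Fact reg_equivariant m n p (e : (m + n)%N = p.+1) (i : 'I_m)
    (r : 'S_m) (r' : 'S_n) x y :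
  reg_comp e (r i) (reg_act x r) (reg_act y r') =
  reg_act (reg_comp e i x y) (pcirc e r r' i).
Proof.
have b1 := reg_bilin e i; have b2 := reg_bilin e (r i).
rewrite (sing_sum x) reg_act_sum (bilin_suml b2) (bilin_suml b1).
rewrite reg_act_sum; apply: eq_bigr => s _.
rewrite (sing_sum y) reg_act_sum (bilin_sumr b2) (bilin_sumr b1).
rewrite reg_act_sum; apply: eq_bigr => t _ /=.
rewrite !reg_act_sing !reg_comp_sing reg_act_sing.
by rewrite invMg permM permK pcircM permKV.
Qed.

Definition reg_operad : operad K :=
  @Operad K reg_ns reg_act reg_act_linear reg_act1 reg_actM reg_equivariant.

End Regular.

Section RegMap.
Variables (K : fieldType) (P Q : nsOperad K) (f : nsHom P Q).

Definition reg_map_fun n (x : reg_operad P n) : reg_operad Q n :=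
  [ffun s => f n ((x : reg_sort P n) s)].

Lemma reg_map_sing n (s : 'S_n) u : reg_map_fun (sing s u) = sing s (f n u).
Proof. by apply/ffunP=> t; rewrite !ffunE; case: eqP => // _; rewrite linear0. Qed.

Fact reg_map_linear n : linear (@reg_map_fun n).
Proof. by move=> a x y; apply/ffunP=> s; rewrite !ffunE linearP. Qed.
HB.instance Definition _ n := GRing.isLinear.Build K (reg_operad P n)
  (reg_operad Q n) _ (@reg_map_fun n) (@reg_map_linear n).

Fact reg_map_one : reg_map_fun (nso_one (reg_operad P)) = nso_one (reg_operad Q).
Proof. by rewrite reg_map_sing nsh_one. Qed.

Fact reg_map_comp m n p (e : (m + n)%N = p.+1) (i : 'I_m) x y :
  reg_map_fun (nso_comp (reg_operad P) e i x y) =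
  nso_comp (reg_operad Q) e i (reg_map_fun x) (reg_map_fun y).
Proof.
rewrite [LHS](linear_sum (@reg_map_fun p)); apply: eq_bigr => s _.
rewrite linear_sum; apply: eq_bigr => t _.
by rewrite [LHS]reg_map_sing nsh_comp !ffunE.
Qed.

Definition reg_map_ns : nsHom (reg_operad P) (reg_operad Q) :=
  NsHom reg_map_linear reg_map_one reg_map_comp.

Fact reg_map_act n (x : reg_operad P n) (s : 'S_n) :
  reg_map_ns n (opd_act (reg_operad P) x s) = opd_act (reg_operad Q) (reg_map_ns n x) s.
Proof. by apply/ffunP=> t; rewrite !ffunE. Qed.

Definition reg_map : opdHom (reg_operad P) (reg_operad Q) := OpdHom reg_map_act.
End RegMap.

Section QuadraticData.
Variables (K : fieldType) (k : nat).
Implicit Types V W : vectType K.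

Lemma tlift_lin V W (U : lmodType K) (b b1 b2 : V -> W -> U) a t :
  (forall v w, b v w = a *: b1 v w + b2 v w) ->
  tlift b t = a *: tlift b1 t + tlift b2 t.
Proof.
move=> h; rewrite /tlift scaler_sumr -big_split; apply: eq_bigr => i _ /=.
rewrite scaler_sumr -big_split; apply: eq_bigr => j _ /=.
by rewrite h scalerDr !scalerA mulrC.
Qed.

Lemma eq_tlift V W (U : lmodType K) (b b' : V -> W -> U) t :
  (forall v w, b v w = b' v w) -> tlift b t = tlift b' t.
Proof. by move=> h; apply: eq_bigr => i _; apply: eq_bigr => j _; rewrite h. Qed.

Lemma tlift2_bilin V W V' W' (U : lmodType K) (G : V -> W -> V' -> W' -> U) :
  bilin (fun s t => tlift (fun v w => tlift (G v w) t) s).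
Proof.
split=> [s a t t'|t a s s']; last exact: linearP.
by apply: tlift_lin => v w; rewrite linearP.
Qed.

Definition quad V : vectType K := {ffun 'I_k -> tensor V V}.

Definition qinj V (i : 'I_k) (t : tensor V V) : quad V :=
  [ffun j => if j == i then t else 0].

Lemma qinj_linear V i : linear (@qinj V i).
Proof.
move=> a u v; apply/ffunP=> t; rewrite !ffunE; case: eqP => // _.
by rewrite scaler0 addr0.
Qed.
HB.instance Definition _ V i :=
  GRing.isLinear.Build K (tensor V V) (quad V) _ (@qinj V i) (qinj_linear i).

Lemma qinj_sum V (x : quad V) : x = \sum_i qinj i (x i).
Proof.
apply/ffunP=> t; rewrite sum_ffunE (bigD1 t) //= ffunE eqxx big1 ?addr0 //.
by move=> s /negPf; rewrite ffunE eq_sym => ->.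
Qed.

Lemma quad_ext V (U : lmodType K) (h h' : quad V -> U) :
  linear h -> linear h' ->
  (forall i v w, h (qinj i (tens v w)) = h' (qinj i (tens v w))) -> h =1 h'.
Proof.
move=> lh lh' e x.
pose H : {linear quad V -> U} := HB.pack h (GRing.isLinear.Build _ _ _ _ h lh).
pose H' : {linear quad V -> U} := HB.pack h' (GRing.isLinear.Build _ _ _ _ h' lh').
rewrite -[h x]/(H x) -[h' x]/(H' x) (qinj_sum x) !linear_sum.
apply: eq_bigr => i _; apply: (@tensor_ext _ _ _ _ (H \o qinj i) (H' \o qinj i)).
- exact: linearP.
- exact: linearP.
- by move=> v w; apply: e.
Qed.

Definition qmap_fun V W (f : 'Hom(V, W)) (x : quad V) : quad W :=
  [ffun i => tmap f f (x i)].
Lemma qmap_linear V W (f : 'Hom(V, W)) : linear (qmap_fun f).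
Proof. by move=> a x y; apply/ffunP=> i; rewrite !ffunE linearP. Qed.
HB.instance Definition _ V W (f : 'Hom(V, W)) :=
  GRing.isLinear.Build K (quad V) (quad W) _ (qmap_fun f) (qmap_linear f).
Definition qmap V W (f : 'Hom(V, W)) : 'Hom(quad V, quad W) := linfun (qmap_fun f).

Lemma qmapE V W (f : 'Hom(V, W)) i v w :
  qmap f (qinj i (tens v w)) = qinj i (tens (f v) (f w)).
Proof.
rewrite lfunE /=; apply/ffunP=> j; rewrite !ffunE; case: eqP => _.
  exact: tmapE.
exact: linear0.
Qed.

Definition dual V : vectType K := 'Hom(V, K^o).

Definition qsign (i : 'I_k) : K := (-1) ^+ (i * k.-1).

Definition qpair V (x : quad V) (y : quad (dual V)) : K^o :=
  \sum_i qsign i *: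
    tlift (fun v w : V => tlift (fun z t : dual V => z v *: t w : K^o) (y i)) (x i).

Lemma qpair_bilin V : bilin (@qpair V).
Proof.
split=> [x a y z|x a y z]; rewrite /qpair scaler_sumr -big_split;
  apply: eq_bigr => i _; rewrite /= scalerA [a * _]mulrC -scalerA -scalerDr;
  congr (_ *: _).
  by apply: tlift_lin => v w; rewrite !ffunE linearP.
by rewrite !ffunE linearP.
Qed.
HB.instance Definition _ V (x : quad V) :=
  GRing.isLinear.Build K (quad (dual V)) K^o _ (qpair x) ((qpair_bilin V).1 x).

Lemma qpairE V i j v w z t :
  @qpair V (qinj i (tens v w)) (qinj j (tens z t)) =
  if i == j then qsign i * (z v * t w) else 0.
Proof.
have b0 v' w' : bilin (fun z t : dual V => z v' *: t w' : K^o).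
  by split=> [z' a t1 t2|t' a z1 z2]; rewrite lfunE /= lfunE /=
    ?scalerDr ?scalerDl ?scalerA // mulrC.
have b1 (y : tensor (dual V) (dual V)) : bilin (fun v w : V =>
    tlift (fun z t : dual V => z v *: t w : K^o) y).
  split=> [v' a w1 w2|w' a v1 v2]; apply: tlift_lin => z' t'; rewrite linearP.
    by rewrite scalerDr !scalerA mulrC.
  by rewrite scalerDl scalerA.
rewrite /qpair (bigD1 i) //= !ffunE eqxx big1 ?addr0 => [|l /negPf hl].
  rewrite tlift_tens //; case: (i == j); last by rewrite linear0 scaler0.
  by rewrite tlift_tens.
by rewrite [X in tlift _ X]ffunE hl linear0 scaler0.
Qed.

Definition qorth V (R : {vspace quad V}) : {vspace quad (dual V)} :=
  (\bigcap_(j < \dim R) lker (linfun (qpair (vbasis R)`_j)))%VS.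

Lemma mem_qorth V (R : {vspace quad V}) y :
  reflect (forall x, x \in R -> qpair x y = 0) (y \in qorth R).
Proof.
rewrite memvE; apply: (iffP idP).
  move/subv_bigcapP => h x /coord_vbasis ->.
  rewrite (bilin_suml (qpair_bilin V)) big1 // => j _.
  rewrite (bilinZl (qpair_bilin V)).
  have := h j isT; rewrite -memvE memv_ker lfunE /= => /eqP ->.
  exact: scaler0.
move=> h; apply/subv_bigcapP => j _; rewrite -memvE memv_ker lfunE /=.
by rewrite h // vbasis_mem // mem_nth // size_tuple.
Qed.

Definition Phi_fun V W (x : quad (tensor V W)) : tensor (quad V) (quad W) :=
  \sum_i tlift (fun s t : tensor V W =>
    tlift (fun v w => tlift (fun v' w' =>
      tens (qinj i (tens v v')) (qinj i (tens w w'))) t) s) (x i).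
Lemma Phi_linear V W : linear (@Phi_fun V W).
Proof.
move=> a x y; rewrite /Phi_fun scaler_sumr -big_split; apply: eq_bigr => i _ /=.
by rewrite !ffunE linearP.
Qed.
HB.instance Definition _ V W := GRing.isLinear.Build K (quad (tensor V W))
  (tensor (quad V) (quad W)) _ (@Phi_fun V W) (@Phi_linear V W).
Definition Phi V W : 'Hom(quad (tensor V W), tensor (quad V) (quad W)) :=
  linfun (@Phi_fun V W).

Lemma PhiE V W i (v v' : V) (w w' : W) :
  Phi V W (qinj i (tens (tens v w) (tens v' w'))) =
  tens (qinj i (tens v v')) (qinj i (tens w w')).
Proof.
rewrite lfunE /= /Phi_fun (bigD1 i) //= ffunE eqxx big1 ?addr0; last first.
  by move=> j /negPf hj; rewrite ffunE hj linear0.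
have bq := tens_bilin (quad V) (quad W).
have bv := tens_bilin V V; have bw := tens_bilin W W.
rewrite tlift_tens; last exact: tlift2_bilin.
rewrite tlift_tens ?tlift_tens //.
- by split=> [x a y z|x a y z]; rewrite ?bw.1 ?bv.1 linearP ?bq.1 ?(bq.2 (qinj i _)).
- split=> [x a y z|x a y z]; apply: tlift_lin => x' y'.
    by rewrite (bw.2 y') linearP bq.1.
  by rewrite (bv.2 x') linearP (bq.2 (qinj i _)).
Qed.

Definition Psi_fun V W (z : tensor (quad V) (quad W)) : quad (tensor V W) :=
  [ffun i => qsign i *: tlift (fun (a : quad V) (b : quad W) =>
    tlift (fun v v' => tlift (fun w w' =>
      tens (tens v w) (tens v' w')) (b i)) (a i)) z].
Lemma Psi_linear V W : linear (@Psi_fun V W).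
Proof.
move=> a x y; apply/ffunP=> i; rewrite !ffunE linearP scalerDr !scalerA.
by rewrite [qsign i * a]mulrC.
Qed.
HB.instance Definition _ V W := GRing.isLinear.Build K
  (tensor (quad V) (quad W)) (quad (tensor V W)) _ (@Psi_fun V W) (@Psi_linear V W).
Definition Psi V W : 'Hom(tensor (quad V) (quad W), quad (tensor V W)) :=
  linfun (@Psi_fun V W).

Lemma PsiE V W i j (v v' : V) (w w' : W) :
  Psi V W (tens (qinj i (tens v v')) (qinj j (tens w w'))) =
  if i == j then qsign i *: qinj i (tens (tens v w) (tens v' w')) else 0.
Proof.
have bq := tens_bilin (tensor V W) (tensor V W).
have bv := tens_bilin V W.
rewrite lfunE /=; apply/ffunP=> l; rewrite ffunE tlift_tens; last first.
  have h := tlift2_bilin (fun (v v' : V) (w w' : W) => tens (tens v w) (tens v' w')).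
  by split=> [x a y z|x a y z]; rewrite !ffunE ?h.1 ?(h.2 (x l)).
rewrite !ffunE; case: (eqVneq l i) => [->|li]; last first.
  rewrite linear0 scaler0; case: eqP => _; last by rewrite ffunE.
  by rewrite !ffunE (negPf li) scaler0.
case: (eqVneq i j) => [->|ij]; last first.
  rewrite ffunE (eq_tlift (b' := fun _ _ => 0)) => [|*].
    by rewrite /tlift !big1 ?scaler0 // => *; rewrite big1 // => *; rewrite scaler0.
  by rewrite linear0.
rewrite !ffunE eqxx tlift_tens ?tlift_tens //.
- by split=> [x a y z|x a y z]; rewrite ?bv.1 ?bq.1 ?(bq.2 (tens _ _)).
- split=> [x a y z|x a y z]; apply: tlift_lin => x' y'.
    by rewrite (bv.2 y') bq.1.
  by rewrite (bv.2 x') (bq.2 (tens _ _)).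
Qed.

Lemma tens_quad_ext V W (U : lmodType K) (h h' : tensor (quad V) (quad W) -> U) :
  linear h -> linear h' ->
  (forall i j v v' w w', h (tens (qinj i (tens v v')) (qinj j (tens w w'))) =
                         h' (tens (qinj i (tens v v')) (qinj j (tens w w')))) ->
  h =1 h'.
Proof.
move=> lh lh' e; have bq := tens_bilin (quad V) (quad W).
apply: tensor_ext => // x y; move: x; apply: quad_ext => [a x x'|a x x'|i v v'].
- by rewrite (bq.2 y) lh.
- by rewrite (bq.2 y) lh'.
move: y; apply: quad_ext => [a x x'|a x x'|j w w'].
- by rewrite bq.1 lh.
- by rewrite bq.1 lh'.
exact: e.
Qed.

Lemma quad_tens_ext V W (U : lmodType K) (h h' : quad (tensor V W) -> U) :
  linear h -> linear h' ->
  (forall i v v' w w', h (qinj i (tens (tens v w) (tens v' w'))) =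
                       h' (qinj i (tens (tens v w) (tens v' w')))) ->
  h =1 h'.
Proof.
move=> lh lh' e; have bq := tens_bilin (tensor V W) (tensor V W).
apply: quad_ext => // i x y; move: x; apply: tensor_ext => [a x x'|a x x'|v w].
- by rewrite (bq.2 y) linearP lh.
- by rewrite (bq.2 y) linearP lh'.
move: y; apply: tensor_ext => [a x x'|a x x'|v' w'].
- by rewrite bq.1 linearP lh.
- by rewrite bq.1 linearP lh'.
exact: e.
Qed.

Lemma Phi_natural V W V' W' (f : 'Hom(V, V')) (g : 'Hom(W, W')) x :
  Phi V' W' (qmap (tmap f g) x) = tmap (qmap f) (qmap g) (Phi V W x).
Proof.
move: x; apply: quad_tens_ext => [a x y|a x y|i v v' w w']; rewrite ?linearP //.
by rewrite PhiE qmapE !tmapE !qmapE PhiE.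
Qed.

Lemma Psi_natural V W V' W' (f : 'Hom(V, V')) (g : 'Hom(W, W')) z :
  Psi V' W' (tmap (qmap f) (qmap g) z) = qmap (tmap f g) (Psi V W z).
Proof.
move: z; apply: tens_quad_ext => [a x y|a x y|i j v v' w w']; rewrite ?linearP //.
rewrite tmapE !qmapE !PsiE; case: eqP => _; last by rewrite linear0.
by rewrite linearZ /= qmapE !tmapE.
Qed.

Definition transp_fun V W (f : 'Hom(V, W)) (z : dual W) : dual V := (z \o f)%VF.
Lemma transp_linear V W (f : 'Hom(V, W)) : linear (transp_fun f).
Proof. by move=> a z t; rewrite /transp_fun comp_lfunDl comp_lfunZl. Qed.
HB.instance Definition _ V W (f : 'Hom(V, W)) :=
  GRing.isLinear.Build K (dual W) (dual V) _ (transp_fun f) (transp_linear f).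
Definition transp V W (f : 'Hom(V, W)) : 'Hom(dual W, dual V) := linfun (transp_fun f).

Lemma transpE V W (f : 'Hom(V, W)) (z : dual W) v : transp f z v = z (f v).
Proof. by rewrite lfunE /= comp_lfunE. Qed.

Lemma qpair_transp V W (f : 'Hom(V, W)) x y :
  qpair x (qmap (transp f) y) = qpair (qmap f x) y.
Proof.
have bV := qpair_bilin V; have bW := qpair_bilin W.
move: x; apply: quad_ext => [a x z|a x z|i v w].
- by rewrite (bV.2 _).
- by rewrite linearP (bW.2 y).
move: y; apply: quad_ext => [a x z|a x z|j z t].
- by rewrite linearP bV.1.
- by rewrite bW.1.
by rewrite !qmapE !qpairE; case: eqP => // _; rewrite !transpE.
Qed.

End QuadraticData.

Section KqReg.
Variables (K : fieldType) (k : nat).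

Record kqReg := KqReg {
  kq_gen : vectType K;
  kq_rel : {vspace quad k kq_gen}
}.
Implicit Types X Y Z : kqReg.

Definition quad_elt (V : vectType K) p (e : (k + k)%N = p.+1) (r : quad k V) :
    free_operad k V p :=
  \sum_i tlift (fun v w =>
    nso_comp (free_operad k V) e i (free_gen k v) (free_gen k w)) (r i).

Lemma quad_elt_linear (V : vectType K) p (e : (k + k)%N = p.+1) :
  linear (@quad_elt V p e).
Proof.
move=> a x y; rewrite /quad_elt scaler_sumr -big_split; apply: eq_bigr => i _ /=.
by rewrite !ffunE linearP.
Qed.

Lemma quad_eltE (V : vectType K) p (e : (k + k)%N = p.+1) i (v w : V) :
  quad_elt e (qinj i (tens v w)) =
  nso_comp (free_operad k V) e i (free_gen k v) (free_gen k w).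
Proof.
rewrite /quad_elt (bigD1 i) //= ffunE eqxx big1 ?addr0; last first.
  by move=> j /negPf hj; rewrite ffunE hj linear0.
have h := nso_bilin (P := free_operad k V) e i.
rewrite tlift_tens //; split=> [x a y z|x a y z]; rewrite linearP.
  exact: h.1.
exact: (h.2 (free_gen k x)).
Qed.

Definition rel_mem X p (x : free_operad k (kq_gen X) p) : Prop :=
  exists (e : (k + k)%N = p.+1) (r : quad k (kq_gen X)),
    r \in kq_rel X /\ x = quad_elt e r.

Definition kq_ideal X : nsIdeal (free_operad k (kq_gen X)) := gen_ideal (@rel_mem X).

Definition kq_ns X : nsOperad K := quot_operad (kq_ideal X).

Definition kq_operad X : operad K := reg_operad (kq_ns X).

Definition kq_in X (v : kq_gen X) : kq_operad X k :=
  sing 1%g (quot_proj (kq_ideal X) k (free_gen k v)).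

Definition preserves_rel X Y (f : 'Hom(kq_gen X, kq_gen Y)) : Prop :=
  (qmap k f @: kq_rel X <= kq_rel Y)%VS.

Record kqHom X Y := KqHom {
  kqh_map :> opdHom (kq_operad X) (kq_operad Y);
  kqh_induced : exists2 f : 'Hom(kq_gen X, kq_gen Y), preserves_rel f &
    forall v, kqh_map k (kq_in v) = kq_in (f v)
}.

Lemma kqHom_eq X Y (f g : kqHom X Y) : (forall n x, f n x = g n x) -> f = g.
Proof.
case: f g => [f hf] [g hg] h; have e : f = g by apply: opdHom_eq.
case: _ / e in hg h *.
by congr KqHom; apply: Prop_irrelevance.
Qed.

Lemma preserves_rel_comp X Y Z (g : 'Hom(kq_gen Y, kq_gen Z))
    (f : 'Hom(kq_gen X, kq_gen Y)) :
  preserves_rel g -> preserves_rel f -> preserves_rel (g \o f)%VF.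
Proof.
move=> hg hf; apply/subvP => _ /memv_imgP[x hx ->].
have -> : qmap k (g \o f)%VF x = qmap k g (qmap k f x).
  move: x {hx}; apply: quad_ext => [a x y|a x y|i v w]; rewrite ?linearP //.
  by rewrite !qmapE !comp_lfunE.
exact/(subvP hg)/memv_img/(subvP hf)/memv_img.
Qed.

Fact kqHom_comp_induced X Y Z (g : kqHom Y Z) (f : kqHom X Y) :
  exists2 h : 'Hom(kq_gen X, kq_gen Z), preserves_rel h &
    forall v, opdHom_comp g f k (kq_in v) = kq_in (h v).
Proof.
have [hf pf ef] := kqh_induced f; have [hg pg eg] := kqh_induced g.
exists (hg \o hf)%VF; first exact: preserves_rel_comp.
by move=> v; rewrite -[LHS]/(g k (f k _)) ef eg comp_lfunE.
Qed.
Definition kqHom_comp X Y Z (g : kqHom Y Z) (f : kqHom X Y) : kqHom X Z :=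
  KqHom (kqHom_comp_induced g f).

Section Induced.
Variables (X Y : kqReg) (f : 'Hom(kq_gen X, kq_gen Y)).
Hypothesis hf : preserves_rel f.

Definition ind_gen (v : kq_gen X) : kq_ns Y k :=
  quot_proj (kq_ideal Y) k (free_gen k (f v)).
Fact ind_gen_linear : linear ind_gen.
Proof. by move=> a v w; rewrite /ind_gen !linearP. Qed.
HB.instance Definition _ :=
  GRing.isLinear.Build K (kq_gen X) (kq_ns Y k) _ ind_gen ind_gen_linear.

Definition ind_free : nsHom (free_operad k (kq_gen X)) (kq_ns Y) := free_lift ind_gen.

Fact ind_free_ker n x : kq_ideal X n x -> ind_free n x = 0.
Proof.
move=> /(_ (nsKer ind_free)); apply => m _ [e [r [hr ->]]].
change (ind_free m (quad_elt e r) = 0).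
have -> : ind_free m (quad_elt e r) = quot_proj (kq_ideal Y) m (quad_elt e (qmap k f r)).
  move: r {hr}; apply: quad_ext => [a x' y|a x' y|i v w].
  - by rewrite quad_elt_linear linearP.
  - by rewrite linearP quad_elt_linear linearP.
  by rewrite qmapE !quad_eltE !nsh_comp !free_lift_gen.
apply/quot_proj0 => I; apply; exists e, (qmap k f r); split => //.
exact/(subvP hf)/memv_img.
Qed.

Definition ind_ns : nsHom (kq_ns X) (kq_ns Y) := quot_lift ind_free_ker.

Fact ind_induced : exists2 h : 'Hom(kq_gen X, kq_gen Y), preserves_rel h &
  forall v, reg_map ind_ns k (kq_in v) = kq_in (h v).
Proof.
exists f => // v; rewrite [LHS]reg_map_sing.
by rewrite [X in sing _ X]quot_lift_proj free_lift_gen.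
Qed.
Definition kqHom_of : kqHom X Y := KqHom ind_induced.
End Induced.

Definition kqh_gen X Y (p : kqHom X Y) : 'Hom(kq_gen X, kq_gen Y) :=
  projT1 (cid2 (kqh_induced p)).
Lemma kqh_gen_rel X Y (p : kqHom X Y) : preserves_rel (kqh_gen p).
Proof. by rewrite /kqh_gen; case: cid2. Qed.
Lemma kqh_genE X Y (p : kqHom X Y) v : p k (kq_in v) = kq_in (kqh_gen p v).
Proof. by rewrite /kqh_gen; case: cid2. Qed.

Definition koszul_dual X : kqReg := @KqReg (dual (kq_gen X)) (qorth (kq_rel X)).

Definition white_prod X Y : kqReg :=
  @KqReg (tensor (kq_gen X) (kq_gen Y))
    (Phi k (kq_gen X) (kq_gen Y) @^-1:
      (tensv (kq_rel X) fullv + tensv fullv (kq_rel Y)))%VS.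

Definition black_prod X Y : kqReg :=
  @KqReg (tensor (kq_gen X) (kq_gen Y))
    (Psi k (kq_gen X) (kq_gen Y) @: tensv (kq_rel X) (kq_rel Y))%VS.

Lemma transp_rel X Y (f : 'Hom(kq_gen X, kq_gen Y)) :
  preserves_rel f -> @preserves_rel (koszul_dual Y) (koszul_dual X) (transp f).
Proof.
move=> hf; apply/subvP => _ /memv_imgP[y /mem_qorth hy ->].
apply/mem_qorth => x hx; rewrite qpair_transp hy //.
exact/(subvP hf)/memv_img.
Qed.

Lemma tmap_tensv (V W V' W' : vectType K) (f : 'Hom(V, V')) (g : 'Hom(W, W'))
    A B A' B' :
  (f @: A <= A')%VS -> (g @: B <= B')%VS ->
  (tmap f g @: tensv A B <= tensv A' B')%VS.
Proof.
move=> hA hB; apply/subvP => _ /memv_imgP[t ht ->]; rewrite memv_preim.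
move: t ht; apply/subvP/tensv_sub => v w hv hw.
rewrite -memv_preim tmapE; apply: tensv_mem.
  exact/(subvP hA)/memv_img.
exact/(subvP hB)/memv_img.
Qed.

Lemma white_rel X X' Y Y' (f : 'Hom(kq_gen X, kq_gen X')) (g : 'Hom(kq_gen Y, kq_gen Y')) :
  preserves_rel f -> preserves_rel g ->
  @preserves_rel (white_prod X Y) (white_prod X' Y') (tmap f g).
Proof.
move=> hf hg; apply/subvP => _ /memv_imgP[x hx ->].
move: hx; rewrite -!memv_preim Phi_natural => /(memv_img (tmap (qmap k f) (qmap k g))).
apply/subvP; rewrite limgD; apply: addvS; apply: tmap_tensv => //; exact: subvf.
Qed.

Lemma black_rel X X' Y Y' (f : 'Hom(kq_gen X, kq_gen X')) (g : 'Hom(kq_gen Y, kq_gen Y')) :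
  preserves_rel f -> preserves_rel g ->
  @preserves_rel (black_prod X Y) (black_prod X' Y') (tmap f g).
Proof.
move=> hf hg; apply/subvP => _ /memv_imgP[_ /memv_imgP[z hz ->] ->].
rewrite -Psi_natural; apply/memv_img/(subvP (tmap_tensv hf hg))/memv_img/hz.
Qed.

Definition koszul_dual_map X Y (p : kqHom X Y) : kqHom (koszul_dual Y) (koszul_dual X) :=
  kqHom_of (transp_rel (kqh_gen_rel p)).

Definition white_prod_map X X' Y Y' (p : kqHom X X') (q : kqHom Y Y') :
    kqHom (white_prod X Y) (white_prod X' Y') :=
  kqHom_of (white_rel (kqh_gen_rel p) (kqh_gen_rel q)).

Definition black_prod_map X X' Y Y' (p : kqHom X X') (q : kqHom Y Y') :
    kqHom (black_prod X Y) (black_prod X' Y') :=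
  kqHom_of (black_rel (kqh_gen_rel p) (kqh_gen_rel q)).
End KqReg.

(* Main.v *)
Require Import Defs.
From HB Require Import structures.
From mathcomp Require Import all_boot all_order all_fingroup all_algebra.
From mathcomp Require Import boolp.

(** The adjunction is tensor-hom duality on generators,
    [Hom(V (x) W, U) = Hom(V, W^* (x) U)], restricted to the linear maps that
    respect the relations; two things have to be checked.

    First, a morphism of quadratic regular operads is the same thing as a
    relation-preserving linear map between spaces of generators. It is
    determined by that map because generators, compositions and the symmetric
    group action exhaust the source ([opdHom_kq_in_eq]). The map can be read off
    from the morphism because generators stay independent in the quotient
    ([kq_in_inj]): the commutative algebra K + V with V^2 = 0, placed in every
    arity, is an operad in which each composite of two generators vanishes, so
    the free operad on V maps to it, killing every quadratic relation and
    remaining injective on V.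

    Secondly, [f : V (x) W -> U] sends Psi(R (x) S) into T exactly when its
    transpose [curry f] sends R into Phi^-1(S^perp (x) F + F (x) T)
    ([black_white_rel]). Pairing the first tensor factor with s gives, for r and
    s quadratic elements over V and W,
    [<s, Phi((curry f) r)> = f (Psi (r (x) s))] ([contr_curry]): the sign in Psi
    is precisely the sign in the pairing. It remains that x lies in
    S^perp (x) F + F (x) T if and only if <s, x> is in T for every s in S
    ([contr_qpair_mem]). This rests on the nondegeneracy of the pairing, which
    provides elements e_j dual to a basis s_j of S; subtracting the sum of the
    e_j (x) <s_j, x> projects x into S^perp (x) F.

    Naturality then only has to be compared on generators, where both sides
    evaluate to the same vector. *)

Set Implicit Arguments.
Unset Strict Implicit.
Unset Printing Implicit Defensive.

Import GRing.Theory.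
Local Open Scope ring_scope.

(** * The square-zero operad *)

Section SquareZero.
Variables (K : fieldType) (V : lmodType K).

Definition sqz : lmodType K := (K^o * V)%type.
(** The product of the square-zero extension K + V. *)
Definition sqz_mul (x y : sqz) : sqz := (x.1 * y.1, x.1 *: y.2 + y.1 *: x.2).

Lemma sqz_mulC : commutative sqz_mul.
Proof. by move=> [a v] [b w]; congr pair; rewrite /= ?(mulrC a) // addrC. Qed.

Lemma sqz_mulA : associative sqz_mul.
Proof.
move=> [a v] [b w] [c u]; congr pair; rewrite /= ?mulrA //.
by rewrite !scalerDr !scalerA addrA (mulrC c a) (mulrC c b).
Qed.

Lemma sqz_mul1 x : sqz_mul x (1, 0) = x.
Proof. by case: x => [a v]; rewrite /sqz_mul /= mulr1 scaler0 scale1r add0r. Qed.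

Lemma sqz_mul_bilin : bilin sqz_mul.
Proof.
have l x : linear (sqz_mul x).
  case: x => [a v] c [b w] [d u].
  have e1 : a * (c * b + d) = c * (a * b) + a * d by rewrite mulrDr mulrCA.
  have e2 : a *: (c *: w + u) + (c * b + d) *: v =
      c *: (a *: w + b *: v) + (a *: u + d *: v).
    by rewrite !scalerDr scalerDl !scalerA (mulrC a c) addrACA.
  exact: (f_equal2 pair e1 e2).
split=> // y c x x'; have := l y c x x'.
by rewrite ![sqz_mul y _]sqz_mulC.
Qed.

(** A commutative algebra, repeated in every arity with all compositions equal to
    its product, is an operad: commutativity is what parallel composition needs. *)
Definition sqz_operad : nsOperad K.
Proof.
apply: (@NsOperad K (fun _ => sqz) (1, 0) (fun _ _ _ _ _ => sqz_mul)).
- by move=> *; exact: sqz_mul_bilin.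
- by move=> *; exact: sqz_mul1.
- by move=> *; rewrite sqz_mulC sqz_mul1.
- by move=> *; rewrite sqz_mulA.
- move=> m n l p q r e1 e2 e3 e4 i j i' j' x y z _ _ _.
  by rewrite -!sqz_mulA (sqz_mulC y).
Defined.
End SquareZero.

(** * Morphisms of quadratic regular operads are linear maps of generators *)

Section Generators.
Variables (K : fieldType) (k : nat).
Implicit Types X Y Z : kqReg K k.

Definition sqz_in (V : lmodType K) (v : V) : sqz_operad V k := (0, v).
Lemma sqz_in_linear (V : lmodType K) : linear (@sqz_in V).
Proof. by move=> a v w; congr pair; rewrite /= scaler0 addr0. Qed.
HB.instance Definition _ (V : lmodType K) := GRing.isLinear.Build K V
  (sqz_operad V k) _ (@sqz_in V) (@sqz_in_linear V).

(** The extension of [sqz_in] to the free operad kills the relations, so the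
    ideal of relations cannot contain a nonzero generator. *)
Lemma kq_in_inj X : injective (@kq_in K k X).
Proof.
move=> v w /(congr1 (fun x : reg_sort (kq_ns X) k => x 1%g)); rewrite !ffunE eqxx.
move=> /qclsP vw; pose F := free_lift (@sqz_in (kq_gen X)).
suff : F k (free_gen k v - free_gen k w) = 0.
  have -> : F k (free_gen k v - free_gen k w) = (0, v) - (0, w) :> sqz _.
    have Fg u : F k (free_gen k u) = sqz_in u := free_lift_gen _ u.
    have FB x y : F k (x - y) = F k x - F k y := linearB (@nsh_map _ _ _ F k) x y.
    by rewrite FB !Fg.
  by case=> _ /eqP; rewrite subr_eq0 => /eqP.
(* a composite of two generators is sent to (0, x) * (0, y) = 0 *)
apply: (vw (nsKer F)) => m _ [e [r [_ ->]]]; change (F m (quad_elt e r) = 0).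
move: r; apply: quad_ext => [a x y|a x y|i x y].
- by rewrite quad_elt_linear linearP.
- by rewrite scaler0 addr0.
rewrite quad_eltE nsh_comp !free_lift_gen.
have e1 : (0 : K) * 0 = 0 by rewrite mul0r.
have e2 : (0 : K) *: y + (0 : K) *: x = 0 by rewrite !scale0r addr0.
exact: (f_equal2 pair e1 e2).
Qed.

Definition reg_in_map (P : nsOperad K) n (u : P n) : reg_operad P n := sing 1%g u.

Lemma pcirc11 m n p (e : (m + n)%N = p.+1) (i : 'I_m) :
  pcirc e 1%g 1%g i = 1%g.
Proof. by apply: (mulgI (pcirc e 1%g 1%g i)); rewrite -{2}(perm1 i) -pcircM !mulg1. Qed.

Definition reg_in (P : nsOperad K) : nsHom P (reg_operad P).
Proof.
apply: (@NsHom K P (reg_operad P) (@reg_in_map P)).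
- by move=> n a x y; rewrite /reg_in_map linearP.
- by [].
- move=> m n p e i x y.
  by rewrite [RHS]reg_comp_sing pcirc11 invg1 perm1.
Defined.

Definition kq_proj X : nsHom (free_operad k (kq_gen X)) (kq_operad X) :=
  nsHom_comp (reg_in (kq_ns X)) (quot_proj (kq_ideal X)).

(** Equivariance reduces the comparison to the identity permutation, where both
    morphisms become maps out of the free operad. *)
Lemma opdHom_kq_in_eq X (Q : operad K) (f g : opdHom (kq_operad X) Q) :
  (forall v, f k (kq_in v) = g k (kq_in v)) -> forall n x, f n x = g n x.
Proof.
move=> fg n; apply: sing_ext => [||s].
- exact: (@nsh_linear _ _ _ f n).
- exact: (@nsh_linear _ _ _ g n).
elim/qclsW => u.
rewrite -[s]mul1g -reg_act_sing [LHS]opdh_act [RHS]opdh_act; congr opd_act.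
pose c v : Q k := f k (kq_in v).
have cl : linear c by move=> a v w; rewrite /c /kq_in !linearP.
pose C : {linear kq_gen X -> Q k} := HB.pack c (GRing.isLinear.Build _ _ _ _ c cl).
rewrite -[LHS]/(nsHom_comp f (kq_proj X) n u).
rewrite -[RHS]/(nsHom_comp g (kq_proj X) n u).
rewrite !(@free_lift_unique _ _ _ _ C) // => v; exact/esym/fg.
Qed.

Lemma kqh_gen_unique X Y (p : kqHom X Y) (f : 'Hom(kq_gen X, kq_gen Y)) :
  (forall v, p k (kq_in v) = kq_in (f v)) -> kqh_gen p = f.
Proof.
by move=> pf; apply/lfunP => v; apply: (@kq_in_inj Y); rewrite -kqh_genE pf.
Qed.

Lemma kqh_gen_inj X Y (p p' : kqHom X Y) : kqh_gen p = kqh_gen p' -> p = p'.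
Proof.
move=> e; apply/kqHom_eq/opdHom_kq_in_eq => v.
by rewrite !kqh_genE e.
Qed.

Lemma kqh_gen_of X Y (f : 'Hom(kq_gen X, kq_gen Y)) (hf : preserves_rel f) :
  kqh_gen (kqHom_of hf) = f.
Proof.
apply: kqh_gen_unique => v; rewrite [LHS]reg_map_sing.
by rewrite [X in sing _ X]quot_lift_proj free_lift_gen.
Qed.

Lemma kqh_gen_comp X Y Z (g : kqHom Y Z) (f : kqHom X Y) :
  kqh_gen (kqHom_comp g f) = (kqh_gen g \o kqh_gen f)%VF.
Proof.
apply: kqh_gen_unique => v.
by rewrite -[LHS]/(g k (f k _)) !kqh_genE comp_lfunE.
Qed.
End Generators.

(** * Contracting the first factor of a tensor *)

Section Contraction.
Variable K : fieldType.
Implicit Types E D : vectType K.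

Lemma scale_bilin E D (phi : {linear E -> K^o}) :
  bilin (fun (y : E) (d : D) => (phi y : K) *: d).
Proof.
split=> [y a d d'|d a y y']; first by rewrite scalerDr !scalerA mulrC.
by rewrite linearP scalerDl scalerA.
Qed.

Definition contr E D (phi : {linear E -> K^o}) (x : tensor E D) : D :=
  tlift (fun y d => (phi y : K) *: d) x.
HB.instance Definition _ E D (phi : {linear E -> K^o}) :=
  GRing.Linear.copy (@contr E D phi) (tlift (fun (y : E) (d : D) => (phi y : K) *: d)).

Lemma contrE E D (phi : {linear E -> K^o}) y (d : D) :
  contr phi (tens y d) = (phi y : K) *: d.
Proof. exact/tlift_tens/scale_bilin. Qed.

Lemma tensv_full E D (x : tensor E D) : x \in tensv fullv fullv.
Proof.
rewrite (tens_basis x) /tlift memv_suml // => i _; rewrite memv_suml // => j _.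
by rewrite memvZ // tensv_mem ?memvf.
Qed.

Lemma contr_tensv E D (phi : {linear E -> K^o}) (A : {vspace E}) (C : {vspace D}) x :
  (forall y, y \in A -> phi y = 0) ->
  x \in (tensv A fullv + tensv fullv C)%VS -> contr phi x \in C.
Proof.
move=> hA hx.
have -> : contr phi x = linfun (contr phi) x by rewrite lfunE.
rewrite memv_preim; move: x hx; apply/subvP; rewrite subv_add.
apply/andP; split; apply: tensv_sub => y d hy hd; rewrite -memv_preim lfunE /= contrE.
  by rewrite hA // scale0r mem0v.
by rewrite memvZ.
Qed.

(** With the [e i] dual to the [phi i], the map [y - \sum_i phi i y *: e i] takes
    its values in [A]; applied to the first factor of [x], it yields the part in
    [A (x) D], and what it removes is [\sum_i e i (x) contr (phi i) x]. *)
Lemma contr_basis_split E D n (phi : 'I_n -> {linear E -> K^o}) (e : 'I_n -> E)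
    (A : {vspace E}) (C : {vspace D}) (x : tensor E D) :
  (forall i j, phi i (e j) = (i == j)%:R) ->
  (forall y, (forall i, phi i y = 0) -> y \in A) ->
  (forall i, contr (phi i) x \in C) ->
  x \in (tensv A fullv + tensv fullv C)%VS.
Proof.
move=> dual_e hA hC.
pose pi_fun y := y - \sum_i (phi i y : K) *: e i.
have pi_lin : linear pi_fun.
  move=> a y z; rewrite /pi_fun scalerBr scaler_sumr.
  rewrite (eq_bigr (fun i => a *: ((phi i y : K) *: e i) + (phi i z : K) *: e i)).
    by rewrite big_split /= opprD addrACA.
  by move=> i _; rewrite linearP scalerDl scalerA.
pose pi_ : {linear E -> E} := HB.pack pi_fun (GRing.isLinear.Build _ _ _ _ pi_fun pi_lin).
pose p := linfun pi_.
have split_x : x = tmap p \1%VF x + \sum_i tens (e i) (contr (phi i) x).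
  have bt := tens_bilin E D.
  move: (x); apply: tensor_ext => [a y z|a y z|y d].
  - by [].
  - rewrite linearP scalerDr -!addrA; congr (_ + _).
    rewrite addrCA; congr (_ + _); rewrite scaler_sumr -big_split.
    by apply: eq_bigr => i _; rewrite linearP bt.1.
  rewrite tmapE id_lfunE lfunE /= /pi_fun (bilinBl bt) (bilin_suml bt).
  rewrite -[LHS]addr0 -addrA; congr (_ + _); apply/esym/eqP; rewrite addrC subr_eq0.
  by apply/eqP/eq_bigr => i _; rewrite contrE (bilinZr bt) (bilinZl bt).
rewrite split_x; apply: memv_add; last first.
  by rewrite memv_suml // => i _; rewrite tensv_mem ?memvf.
have pA : (p @: fullv <= A)%VS.
  apply/subvP => _ /memv_imgP[y _ ->]; apply: hA => i; rewrite lfunE /= /pi_fun.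
  rewrite linearB linear_sum (bigD1 i) //= linearZ /= dual_e eqxx big1.
    by rewrite addr0 -[_ *: _]/(_ * _) mulr1 subrr.
  by move=> j ji; rewrite linearZ /= dual_e eq_sym (negPf ji) scaler0.
have id_full : (\1%VF @: {:D} <= {:D})%VS by exact: subvf.
exact/(subvP (tmap_tensv pA id_full))/memv_img/tensv_full.
Qed.

End Contraction.

(** * Tensor-hom duality *)

Section Currying.
Variable K : fieldType.
Implicit Types V W U : vectType K.

Definition app V (w : V) (z : dual V) : K^o := z w.
Lemma app_linear V (w : V) : linear (app w).
Proof. by move=> a z t; rewrite /app !lfunE /= lfunE. Qed.
HB.instance Definition _ V (w : V) :=
  GRing.isLinear.Build K (dual V) K^o _ (app w) (app_linear w).

(** An element of [W^* (x) U], seen as a map from [W] to [U]. *)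
Definition ev W U (w : W) : tensor (dual W) U -> U := contr (app w).
HB.instance Definition _ W U (w : W) :=
  GRing.Linear.copy (@ev W U w) (contr (app w)).

Lemma evE W U (w : W) z (u : U) : ev w (tens z u) = (z w : K) *: u.
Proof. exact: contrE. Qed.

Lemma ev_linear_l W U (x : tensor (dual W) U) : linear (fun w => ev w x).
Proof.
move=> a w w'; rewrite /ev /contr; apply: tlift_lin => z u.
by rewrite /= /app linearP scalerDl scalerA.
Qed.

Definition covec W (i : 'I_(\dim {:W})) : dual W := linfun (coord (vbasis {:W}) i : W -> K^o).

(** The inverse of [ev]: the element of [W^* (x) U] that represents [h]. *)
Definition tensor_of_map W U (h : W -> U) : tensor (dual W) U :=
  \sum_(i < \dim {:W}) tens (covec i) (h (vbasis {:W})`_i).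

Lemma ev_tensor_of_map W U (h : W -> U) w : linear h -> ev w (tensor_of_map h) = h w.
Proof.
move=> lh.
pose H : {linear W -> U} := HB.pack h (GRing.isLinear.Build _ _ _ _ h lh).
rewrite -[RHS]/(H w) [w in RHS](coord_vbasis (memvf w)) linear_sum /tensor_of_map linear_sum.
by apply: eq_bigr => i _; rewrite /= evE lfunE; exact: (esym (linearZZ H _ _)).
Qed.

Lemma tensor_of_map_ev W U (x : tensor (dual W) U) : tensor_of_map (fun w => ev w x) = x.
Proof.
have bt := tens_bilin (dual W) U.
move: x; apply: tensor_ext => [a x y|a x y|z u].
- rewrite /tensor_of_map scaler_sumr -big_split; apply: eq_bigr => i _.
  by rewrite linearP bt.1.
- by [].
rewrite /tensor_of_map (eq_bigr (fun i : 'I_(\dim {:W}) =>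
    tens ((z (vbasis {:W})`_i : K) *: covec i) u)).
  rewrite -(bilin_suml bt); congr tens; apply/lfunP => w.
  rewrite [w in RHS](coord_vbasis (memvf w)) sum_lfunE linear_sum.
  by apply: eq_bigr => i _; rewrite !lfunE /= lfunE linearZ /= [LHS]mulrC.
by move=> i _; rewrite evE (bilinZr bt) (bilinZl bt).
Qed.

Lemma ev_inj W U (x y : tensor (dual W) U) : (forall w, ev w x = ev w y) -> x = y.
Proof.
move=> e; rewrite -(tensor_of_map_ev x) -(tensor_of_map_ev y).
by apply: eq_bigr => i _; rewrite e.
Qed.

(** Through [ev], acting on [W^* (x) U] by [q^t (x) r] is composing with [q] and
    [r]; naturality of the adjunction follows from this. *)
Lemma ev_tmap W W' U U' (q : 'Hom(W', W)) (r : 'Hom(U, U')) w x :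
  ev w (tmap (transp q) r x) = r (ev (q w) x).
Proof.
move: x; apply: tensor_ext => [a x y|a x y|z u]; rewrite ?linearP //.
by rewrite tmapE !evE transpE linearZ.
Qed.

Definition curry_fun V W U (f : 'Hom(tensor V W, U)) (v : V) : tensor (dual W) U :=
  tensor_of_map (fun w => f (tens v w)).
Lemma ev_curry_fun V W U (f : 'Hom(tensor V W, U)) v w :
  ev w (curry_fun f v) = f (tens v w).
Proof. by rewrite ev_tensor_of_map // => a x y; rewrite (tens_bilin V W).1 linearP. Qed.
Lemma curry_linear V W U (f : 'Hom(tensor V W, U)) : linear (curry_fun f).
Proof.
move=> a v v'; apply: ev_inj => w; rewrite linearP /= !ev_curry_fun.
by rewrite ((tens_bilin V W).2 w) linearP.
Qed.
HB.instance Definition _ V W U (f : 'Hom(tensor V W, U)) :=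
  GRing.isLinear.Build K V (tensor (dual W) U) _ (curry_fun f) (curry_linear f).
Definition curry V W U (f : 'Hom(tensor V W, U)) : 'Hom(V, tensor (dual W) U) :=
  linfun (curry_fun f).

Lemma curryE V W U (f : 'Hom(tensor V W, U)) v w : ev w (curry f v) = f (tens v w).
Proof. by rewrite lfunE ev_curry_fun. Qed.

Definition uncurry V W U (g : 'Hom(V, tensor (dual W) U)) : 'Hom(tensor V W, U) :=
  linfun (tlift (fun v w => ev w (g v))).

Lemma uncurryE V W U (g : 'Hom(V, tensor (dual W) U)) v w :
  uncurry g (tens v w) = ev w (g v).
Proof.
rewrite lfunE /= tlift_tens //; split=> [x|y a x x']; first exact: ev_linear_l.
by rewrite !linearP.
Qed.

Lemma curryK V W U : cancel (@curry V W U) (@uncurry V W U).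
Proof.
move=> f; apply/lfunP; apply: tensor_ext => [||v w]; [exact: linearP..|].
by rewrite uncurryE curryE.
Qed.

Lemma uncurryK V W U : cancel (@uncurry V W U) (@curry V W U).
Proof. by move=> g; apply/lfunP => v; apply: ev_inj => w; rewrite curryE uncurryE. Qed.
End Currying.

(** * Duality between quadratic elements *)

Section QuadraticDuality.
Variables (K : fieldType) (k : nat).
Implicit Types V W U : vectType K.

Lemma qsignK (i : 'I_k) : qsign K i * qsign K i = 1.
Proof. by rewrite -expr2 /qsign -exprM mulnC exprM sqrrN expr1n expr1n. Qed.

(** The tensors of basis vectors and those of their dual basis vectors are dual
    for [qpair] up to the signs [qsign], which the coefficients of the witness
    compensate. *)
Lemma qpair_left_nondeg W (phi : {linear quad k W -> K^o}) :
  exists y, forall s, qpair s y = phi s.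
Proof.
pose b i := (vbasis {:W})`_i.
exists (\sum_i \sum_(l < \dim {:W}) \sum_(m < \dim {:W})
  (qsign K i * phi (qinj i (tens (b l) (b m)))) *:
    qinj i (tens (covec l) (covec m))).
have bq := @qpair_bilin K k W; have bw := tens_bilin W W.
apply: quad_ext => [a x y|a x y|j v w]; [exact: bq.2 | exact: linearP|].
rewrite (bilin_sumr bq) (bigD1 j) //= [X in _ + X]big1 ?addr0; last first.
  move=> i /negPf ij; rewrite (bilin_sumr bq) big1 // => l _.
  rewrite (bilin_sumr bq) big1 // => m _.
  by rewrite (bilinZr bq) qpairE eq_sym ij scaler0.
rewrite [v in RHS](coord_vbasis (memvf v)) [w in RHS](coord_vbasis (memvf w)).
rewrite (bilin_suml bw) ![in RHS]linear_sum (bilin_sumr bq); apply: eq_bigr => l _.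
rewrite (bilin_sumr bw) ![in RHS]linear_sum (bilin_sumr bq); apply: eq_bigr => m _.
rewrite (bilinZl bw) (bilinZr bw) ![in RHS]linearZ (bilinZr bq) qpairE eqxx !lfunE /=.
set c := coord _ l v; set d := coord _ m w; set f := phi _.
rewrite -![_ *: _]/(_ * _).
by rewrite mulrACA qsignK mul1r mulrC mulrA.
Qed.

(** The subspace [S^perp (x) F + F (x) T] entering the white product is cut out by
    contractions with [S]. *)
Lemma contr_qpair_mem W U (S : {vspace quad k W}) (T : {vspace quad k U}) x :
  (forall s, s \in S -> contr (qpair s) x \in T) <->
  x \in (tensv (qorth S) fullv + tensv fullv T)%VS.
Proof.
split=> [h|h s hs]; last first.
  by apply: contr_tensv h => y /mem_qorth; apply.
(* elements dual to a basis of S *)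
have /choice[e he] : forall j, exists y, forall s,
    qpair s y = (coord (vbasis S) j s : K^o).
  by move=> j; exact: (qpair_left_nondeg (coord (vbasis S) j)).
apply: (@contr_basis_split _ _ _ _ (fun i => qpair (vbasis S)`_i) e) => [i j|y hy|i].
- by rewrite [LHS]he coord_free ?(basis_free (vbasisP _)) // eq_sym.
- apply/mem_qorth => s /coord_vbasis ->.
  rewrite (bilin_suml (@qpair_bilin K k W)) big1 // => i _.
  by rewrite (bilinZl (@qpair_bilin K k W)) [qpair _ _]hy scaler0.
- by apply/h/vbasis_mem/mem_nth; rewrite size_tuple.
Qed.

Lemma contr_qpair_gen W U i j (w w' : W) (x x' : tensor (dual W) U) :
  contr (qpair (qinj j (tens w w'))) (Phi k (dual W) U (qinj i (tens x x'))) =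
  if i == j then qsign K i *: qinj i (tens (ev w x) (ev w' x')) else 0.
Proof.
have bx := tens_bilin (tensor (dual W) U) (tensor (dual W) U).
have bu := tens_bilin U U.
move: x; apply: tensor_ext => [a x y|a x y|z u].
- by rewrite (bx.2 x') !linearP.
- rewrite linearP (bu.2 (ev w' x')) linearP; case: eqP => _.
    by rewrite scalerDr !scalerA mulrC.
  by rewrite scaler0 addr0.
move: x'; apply: tensor_ext => [a x y|a x y|z' u'].
- by rewrite bx.1 !linearP.
- rewrite linearP bu.1 linearP; case: eqP => _.
    by rewrite scalerDr !scalerA mulrC.
  by rewrite scaler0 addr0.
rewrite PhiE contrE /= qpairE [j == i]eq_sym; case: eqP => [->|_]; last exact: scale0r.
by rewrite !evE (bilinZl bu) (bilinZr bu) !linearZ /= !scalerA mulrC.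
Qed.

(** Contraction turns [Phi] into [Psi]: the Kronecker symbol and the sign that
    the pairing contributes on the left are those in [Psi] on the right. *)
Lemma contr_curry V W U (f : 'Hom(tensor V W, U)) r s :
  contr (qpair s) (Phi k (dual W) U (qmap k (curry f) r)) =
  qmap k f (Psi k V W (tens r s)).
Proof.
have bq := @qpair_bilin K k W; have bt := tens_bilin (quad k V) (quad k W).
move: r; apply: quad_ext => [a x y|a x y|i v v'].
- by rewrite !linearP.
- by rewrite (bt.2 s) !linearP.
move: s; apply: quad_ext => [a x y|a x y|j w w'].
- rewrite /contr; apply: tlift_lin => z d.
  by rewrite /= (bq.2 z) scalerDl scalerA.
- by rewrite bt.1 !linearP.
rewrite qmapE contr_qpair_gen PsiE !curryE; case: eqP => _; last by rewrite linear0.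
by rewrite linearZ /= qmapE.
Qed.
End QuadraticDuality.

(** * The adjunction *)

Section Adjunction.
Variables (K : fieldType) (k : nat).
Implicit Types P Q R : kqReg K k.

(** By [contr_qpair_mem] and [contr_curry], both sides say that
    [f (Psi (r (x) s)) \in T] for all relations [r] of [P] and [s] of [Q], where
    [T] is the space of relations of [R]. *)
Lemma black_white_rel P Q R (f : 'Hom(tensor (kq_gen P) (kq_gen Q), kq_gen R)) :
  @preserves_rel _ _ (black_prod P Q) R f <->
  @preserves_rel _ _ P (white_prod (koszul_dual Q) R) (curry f).
Proof.
split=> hf.
  apply/subvP => _ /memv_imgP[r hr ->]; rewrite -memv_preim.
  apply/contr_qpair_mem => s hs; rewrite contr_curry.
  exact/(subvP hf)/memv_img/memv_img/tensv_mem.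
apply/subvP => _ /memv_imgP[_ /memv_imgP[z hz ->] ->].
rewrite memv_preim memv_preim; move: z hz; apply/subvP/tensv_sub => r s hr hs.
rewrite -!memv_preim -contr_curry; move: s hs; apply/contr_qpair_mem.
by have := subvP hf _ (memv_img (qmap k (curry f)) hr); rewrite -memv_preim.
Qed.

Definition adjunct P Q R (f : kqHom (black_prod P Q) R) :
    kqHom P (white_prod (koszul_dual Q) R) :=
  kqHom_of ((black_white_rel (kqh_gen f)).1 (kqh_gen_rel f)).

Lemma adjunct_gen P Q R (f : kqHom (black_prod P Q) R) :
  kqh_gen (adjunct f) = curry (kqh_gen f).
Proof. exact: kqh_gen_of. Qed.

Lemma adjunct_bij P Q R : bijective (@adjunct P Q R).
Proof.
have urel (g : kqHom P (white_prod (koszul_dual Q) R)) :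
    @preserves_rel _ _ (black_prod P Q) R (uncurry (kqh_gen g)).
  by apply/black_white_rel; rewrite uncurryK; exact: kqh_gen_rel.
exists (fun g => kqHom_of (urel g)) => [f|g]; apply: kqh_gen_inj.
  by rewrite kqh_gen_of adjunct_gen curryK.
by rewrite adjunct_gen kqh_gen_of uncurryK.
Qed.

(** On generators, both sides send [v] to the element of [W^* (x) U] representing
    [w |-> r (f (p v (x) q w))]. *)
Lemma adjunct_natural P P' Q Q' R R' (p : kqHom P' P) (q : kqHom Q' Q) (r : kqHom R R')
    (f : kqHom (black_prod P Q) R) :
  adjunct (kqHom_comp r (kqHom_comp f (black_prod_map p q))) =
  kqHom_comp (white_prod_map (koszul_dual_map q) r) (kqHom_comp (adjunct f) p).
Proof.
apply: kqh_gen_inj; rewrite adjunct_gen !kqh_gen_comp adjunct_gen !kqh_gen_of.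
apply/lfunP => v; apply: ev_inj => w.
by rewrite curryE !comp_lfunE ev_tmap curryE tmapE.
Qed.
End Adjunction.

Unset Implicit Arguments.

Theorem theorem40 (K : fieldType) (hK : [pchar K] =i pred0)
    (k : nat) (hk : (2 <= k)%N) :
  exists Theta : forall P Q R : kqReg K k,
      kqHom (black_prod P Q) R -> kqHom P (white_prod (koszul_dual Q) R),
    (forall P Q R : kqReg K k, bijective (Theta P Q R)) /\
    (forall (P P' Q Q' R R' : kqReg K k)
        (p : kqHom P' P) (q : kqHom Q' Q) (r : kqHom R R')
        (f : kqHom (black_prod P Q) R),
      Theta P' Q' R' (kqHom_comp r (kqHom_comp f (black_prod_map p q))) =
      kqHom_comp (white_prod_map (koszul_dual_map q) r)
        (kqHom_comp (Theta P Q R f) p)).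
Proof.
exists (@adjunct K k); split=> [P Q R|]; first exact: adjunct_bij.
exact: adjunct_natural.
Qed.
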